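(* Let $\Lambda$ be an artin algebra. (i) If every indecomposable non-projective right $\Lambda$-module is uniserial, then $\Lambda$ is either Nakayama or right $2$-Nakayama. (ii) If every indecomposable non-injective right $\Lambda$-module is uniserial, then $\Lambda$ is either Nakayama or left $2$-Nakayama.
   Context: An artin algebra is an algebra $\Lambda$ over a commutative artinian ring $R$ that is finitely generated as an $R$-module. All modules are finitely generated. A module is uniserial if it has a unique composition series (the zero module counts as uniserial). $\Lambda$ is a Nakayama algebra if all indecomposable projective and all indecomposable injective right $\Lambda$-modules are uniserial. For a (left or right) module $M$ put $\mathrm{rad}^0(M)=M$, $\mathrm{rad}^{i+1}(M)=\mathrm{rad}(\mathrm{rad}^i(M))$. Let $M$ be a nonzero module of length $l$. $M$ is $1$-factor serial if it is uniserial; for $l\ge 2$, $M$ is $2$-factor serial if $M/\mathrm{rad}^{l-2}(M)$ is uniserial and $M/\mathrm{rad}^{l-1}(M)$ is not uniserial. $\Lambda$ is right (resp. left) $2$-Nakayama if every indecomposable right (resp. left) $\Lambda$-module is $1$-factor serial or $2$-factor serial and there exists at least one indecomposable $2$-factor serial right (resp. left) $\Lambda$-module. *)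

(* Defs.v *)
From HB Require Import structures.
From mathcomp Require Import all_boot all_algebra.
From mathcomp Require Import boolp.

Set Implicit Arguments.
Unset Strict Implicit.
Unset Printing Implicit Defensive.

Import GRing.Theory.

Local Open Scope ring_scope.
Local Open Scope quotient_scope.

(* Conventions.  A left module over a ring S is an [lmodType S]; a right
   S-module is an [lmodType S^c], a left module over the converse ring.
   A submodule of M is a [submodClosed M]; as every proposition is decided
   classically, these boolean predicates account for all submodules. *)

Section Submodules.
Variables (S : pzRingType) (M : lmodType S).

Definition full_pred : {pred M} := fun _ => true.
Fact full_submod_closed : submod_closed full_pred. Proof. by []. Qed.
HB.instance Definition _ :=
  GRing.isSubmodClosed.Build S M full_pred full_submod_closed.
Definition full : submodClosed M := full_pred.

Definition maximal_submod (K N : submodClosed M) : Prop :=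
  [/\ {subset K <= N}, ~ (K =i N) &
      forall L : submodClosed M,
        {subset K <= L} -> {subset L <= N} -> L =i K \/ L =i N].

Definition rad_pred (N : submodClosed M) : {pred M} := fun x =>
  `[< x \in N /\ forall K : submodClosed M, maximal_submod K N -> x \in K >].
Fact rad_submod_closed N : submod_closed (rad_pred N).
Proof.
have radE x : reflect
    (x \in N /\ forall K : submodClosed M, maximal_submod K N -> x \in K)
    (x \in rad_pred N) by exact: asboolP.
split; first by apply/radE; split=> [|K _]; exact: (submodClosedP _).1.
move=> a u v /radE[Nu Ku] /radE[Nv Kv]; apply/radE.
by split=> [|K maxK]; apply: (submodClosedP _).2; auto.
Qed.
HB.instance Definition _ N :=
  GRing.isSubmodClosed.Build S M (rad_pred N) (rad_submod_closed N).
Definition rad (N : submodClosed M) : submodClosed M := rad_pred N.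

Definition rad_iter (i : nat) : submodClosed M := iter i rad full.

(* F 0 = 0 < F 1 < ... < F l = M with simple factors; the values of F beyond
   l are irrelevant. *)
Definition composition_series (l : nat) (F : nat -> submodClosed M) : Prop :=
  [/\ F 0%N =i pred1 0, F l =i full &
      forall i, (i < l)%N -> maximal_submod (F i) (F i.+1)].

Definition has_length (l : nat) : Prop := exists F, composition_series l F.

Definition uniserial : Prop :=
  exists l F, composition_series l F /\
    forall l' F', composition_series l' F' ->
      l' = l /\ forall i, (i <= l)%N -> F' i =i F i.

Definition nonzero : Prop := exists x : M, x != 0.

Definition indecomposable : Prop :=
  nonzero /\
  forall K L : submodClosed M,
    (forall x, x \in K -> x \in L -> x = 0) ->
    (forall x, exists y z, [/\ y \in K, z \in L & x = y + z]) ->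
    K =i pred1 0 \/ L =i pred1 0.

Definition finitely_generated : Prop :=
  exists (n : nat) (g : 'I_n -> M),
    forall x, exists a : 'I_n -> S, x = \sum_(i < n) a i *: g i.

(* Descending chain condition on submodules. *)
Definition artinian_module : Prop :=
  forall F : nat -> submodClosed M,
    (forall n, {subset F n.+1 <= F n}) ->
    exists n, forall m, (n <= m)%N -> F m =i F n.

End Submodules.

Arguments rad_iter {S} M i.
Arguments full {S M}.

Section QuotientModule.
Variables (S : pzRingType) (M : lmodType S) (N : submodClosed M).

(* A [submodClosed] does not inherit from [zmodClosed], which [Quotient.quot] needs. *)
Definition quot_pred : {pred M} := N.
Fact quot_zmod_closed : zmod_closed quot_pred.
Proof. exact: GRing.submod_closedB (submodClosedP N). Qed.
HB.instance Definition _ := GRing.isZmodClosed.Build M quot_pred quot_zmod_closed.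

Definition quot_mod : Type := Quotient.quot quot_pred.
HB.instance Definition _ := GRing.Zmodule.on quot_mod.
HB.instance Definition _ := EqQuotient.on quot_mod.

Definition quot_scale (a : S) (u : quot_mod) : quot_mod :=
  \pi_(quot_mod) (a *: repr u).

Fact quot_eqP (x y : M) :
  reflect (\pi_(quot_mod) x = \pi_(quot_mod) y) (x - y \in N).
Proof.
have -> : (x - y \in N) = (\pi_(quot_mod) x == \pi_(quot_mod) y).
  exact: (@Quotient.idealrBE M quot_pred x y).
exact: eqP.
Qed.

Fact quot_scaleE a (x : M) :
  quot_scale a (\pi_(quot_mod) x) = \pi_(quot_mod) (a *: x).
Proof.
apply/quot_eqP; rewrite -scalerBr; apply: rpredZ.
by apply/quot_eqP; rewrite reprK.
Qed.

Fact quot_piD (x y : M) :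
  \pi_(quot_mod) (x + y) = \pi_(quot_mod) x + \pi_(quot_mod) y.
Proof. exact: (@Quotient.pi_add M quot_pred). Qed.

Fact quot_scalerA a b u : quot_scale a (quot_scale b u) = quot_scale (a * b) u.
Proof. by rewrite -[u]reprK (quot_scaleE b (repr u)) !quot_scaleE scalerA. Qed.
Fact quot_scale1r : left_id 1 quot_scale.
Proof. by move=> u; rewrite -[u]reprK quot_scaleE scale1r. Qed.
Fact quot_scalerDr : right_distributive quot_scale +%R.
Proof.
by move=> a u v; rewrite -[u]reprK -[v]reprK -quot_piD !quot_scaleE -quot_piD
  scalerDr.
Qed.
Fact quot_scalerDl u : {morph quot_scale^~ u : a b / a + b}.
Proof. by move=> a b; rewrite -[u]reprK !quot_scaleE -quot_piD scalerDl. Qed.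

HB.instance Definition _ := GRing.Zmodule_isLmodule.Build S quot_mod
  quot_scalerA quot_scale1r quot_scalerDr quot_scalerDl.
End QuotientModule.

Section ModuleClasses.
Variables (S : pzRingType) (M : lmodType S).

(* All modules being finitely generated, projectivity and injectivity are
   tested in the category of finitely generated modules. *)
Definition projective_module : Prop :=
  forall (X Y : lmodType S) (g : {linear X -> Y}) (h : {linear M -> Y}),
    finitely_generated X -> finitely_generated Y ->
    (forall y, exists x, g x = y) ->
    exists k : {linear M -> X}, forall m, g (k m) = h m.

Definition injective_module : Prop :=
  forall (X Y : lmodType S) (f : {linear X -> Y}) (h : {linear X -> M}),
    finitely_generated X -> finitely_generated Y -> injective f ->
    exists k : {linear Y -> M}, forall x, k (f x) = h x.

Definition factor_serial1 : Prop := nonzero M /\ uniserial M.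

Definition factor_serial2 : Prop :=
  exists l : nat, [/\ (2 <= l)%N, has_length M l,
    uniserial (quot_mod (rad_iter M (l - 2))) &
    ~ uniserial (quot_mod (rad_iter M (l - 1)))].

End ModuleClasses.

Section TwoNakayama.
Variable S : pzRingType.

(* The left-module version; instantiated at S^c it is the right one. *)
Definition two_Nakayama : Prop :=
  (forall M : lmodType S, finitely_generated M -> indecomposable M ->
     factor_serial1 M \/ factor_serial2 M) /\
  (exists M : lmodType S,
     [/\ finitely_generated M, indecomposable M & factor_serial2 M]).
End TwoNakayama.

Definition left_2Nakayama (A : pzRingType) : Prop := two_Nakayama A.
Definition right_2Nakayama (A : pzRingType) : Prop := two_Nakayama A^c.

Definition Nakayama (A : pzRingType) : Prop :=
  forall M : lmodType A^c, finitely_generated M -> indecomposable M ->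
    projective_module M \/ injective_module M -> uniserial M.

Definition artin_algebra (R : comPzRingType) (A : algType R) : Prop :=
  artinian_module R^o /\ finitely_generated (A : lmodType R).

(* Main.v *)
(** A nonzero quotient M/N of an indecomposable projective M, with N <> 0, is
    indecomposable (M has a unique maximal submodule) and not projective, hence
    uniserial.  If M itself is not uniserial, two incomparable submodules must
    then meet in 0, so the submodules of M are 0, some simple ones, and a chain
    above the sum T of two distinct simple submodules; the radical series of M
    runs down this chain to T and then to 0, and M is 2-factor serial.  This
    proves (i) for any ring whose finitely generated modules have finite length.

    Part (ii) follows by applying this to left modules through the duality
    Hom_R(-, E).  The cogenerator E needs no injective hulls: call a module
    multiplicity-free if its socle contains each simple module at most once.  The
    length of such a module is at most that of R, so one of maximal length
    exists, and maximality alone makes it a cogenerator for modules of finite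
    length.  The duality is used through perfect pairings M x N -> E, whose
    orthogonals reverse the lattices of submodules. *)
Require Import Defs.
From HB Require Import structures.
From mathcomp Require Import all_boot all_algebra.
From mathcomp Require Import boolp classical_sets functions.

Set Implicit Arguments.
Unset Strict Implicit.
Unset Printing Implicit Defensive.

Import GRing.Theory.
Local Open Scope ring_scope.

(** * Submodules and length *)

Section Lattice.
Variables (S : pzRingType) (M : lmodType S).
Implicit Types (K L N : submodClosed M).

(** Predicate extensionality and proof irrelevance turn equality of elements into Leibniz equality,
    so submodules can be rewritten. *)
Lemma submod_ext K L : K =i L -> K = L.
Proof.
case: K L => [K [[cK] [dK]]] [L [[cL] [dL]]] KL.
have {}KL : K = L by apply: funext => x; apply: KL.
case: L / KL cL dL => cL dL.
by rewrite (Prop_irrelevance cK cL) (Prop_irrelevance dK dL).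
Qed.

Lemma submod_sub_eq K L : {subset K <= L} -> {subset L <= K} -> K = L.
Proof. by move=> KL LK; apply: submod_ext => x; apply/idP/idP => [/KL|/LK]. Qed.

Lemma submodN K x : x \in K -> - x \in K.
Proof. by move=> xK; rewrite -scaleN1r rpredZ. Qed.

Lemma submodB K x y : x \in K -> y \in K -> x - y \in K.
Proof. by move=> xK yK; rewrite rpredD ?submodN. Qed.

Definition closed_prop (P : M -> Prop) :=
  P 0 /\ forall a u v, P u -> P v -> P (a *: u + v).

Definition prop_pred (P : M -> Prop) : {pred M} := fun x => `[< P x >].

Lemma prop_pred_closed P : closed_prop P -> submod_closed (prop_pred P).
Proof.
move=> [P0 PD]; split; first exact/asboolP.
by move=> a u v /asboolP Pu /asboolP Pv; apply/asboolP; apply: PD.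
Qed.

Definition submod_of P (cP : closed_prop P) : submodClosed M :=
  HB.pack (prop_pred P)
    (GRing.isSubmodClosed.Build S M (prop_pred P) (prop_pred_closed cP)).

Lemma submod_ofP P (cP : closed_prop P) x : x \in submod_of cP <-> P x.
Proof. by split=> [/asboolP|Px]; last apply/asboolP. Qed.

Lemma zero_closed : closed_prop (fun x => x = 0).
Proof. by split=> // a u v -> ->; rewrite scaler0 addr0. Qed.
Definition zero_sub := submod_of zero_closed.

Lemma cap_closed K L : closed_prop (fun x => x \in K /\ x \in L).
Proof.
by split=> [|a u v [uK uL] [vK vL]]; split; rewrite ?rpred0 // rpredD ?rpredZ.
Qed.
Definition cap_sub K L := submod_of (cap_closed K L).

Lemma add_closed K L :
  closed_prop (fun x => exists y z, [/\ y \in K, z \in L & x = y + z]).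
Proof.
split=> [|a _ _ [y [z [yK zL ->]]] [y' [z' [yK' zL' ->]]]].
  by exists 0, 0; rewrite !rpred0 addr0.
exists (a *: y + y'), (a *: z + z'); rewrite scalerDr addrACA.
by rewrite !rpredD ?rpredZ.
Qed.
Definition add_sub K L := submod_of (add_closed K L).

Lemma cyclic_closed v : closed_prop (fun x => exists a, x = a *: v).
Proof.
split=> [|a _ _ [b ->] [c ->]]; first by exists 0; rewrite scale0r.
by exists (a * b + c); rewrite scalerDl scalerA.
Qed.
Definition cyclic_sub v := submod_of (cyclic_closed v).

Lemma mem_zero x : (x \in zero_sub) = (x == 0).
Proof. by apply/idP/eqP => [/submod_ofP//|->]; apply: rpred0. Qed.

Lemma zero_sub_min K : {subset zero_sub <= K}.
Proof. by move=> x; rewrite mem_zero => /eqP->; apply: rpred0. Qed.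

Lemma sub_full K : {subset K <= full}. Proof. by []. Qed.

Lemma eq_zero_sub K : (forall x, x \in K -> x = 0) -> K = zero_sub.
Proof.
move=> K0; apply: submod_sub_eq; last exact: zero_sub_min.
by move=> x /K0->; rewrite rpred0.
Qed.

Lemma eq_full K : (forall x, x \in K) -> K = full.
Proof. by move=> KT; apply: submod_ext => x; rewrite KT. Qed.

Lemma subNP K L : ~ {subset K <= L} -> exists2 x, x \in K & x \notin L.
Proof.
move=> nKL; apply: contrapT => nx; apply: nKL => x xK.
by apply: contrapT => /negP xL; apply: nx; exists x.
Qed.

Lemma sub_addl K L : {subset K <= add_sub K L}.
Proof. by move=> x xK; apply/submod_ofP; exists x, 0; rewrite rpred0 addr0. Qed.

Lemma sub_addr K L : {subset L <= add_sub K L}.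
Proof. by move=> x xL; apply/submod_ofP; exists 0, x; rewrite rpred0 add0r. Qed.

Lemma add_sub_le K L N :
  {subset K <= N} -> {subset L <= N} -> {subset add_sub K L <= N}.
Proof. by move=> KN LN x /submod_ofP[y [z [/KN yN /LN zN ->]]]; rewrite rpredD. Qed.

Lemma sub_capl K L : {subset cap_sub K L <= K}.
Proof. by move=> x /submod_ofP[]. Qed.

Lemma sub_capr K L : {subset cap_sub K L <= L}.
Proof. by move=> x /submod_ofP[]. Qed.

Lemma cap_sub_ge K L N :
  {subset N <= K} -> {subset N <= L} -> {subset N <= cap_sub K L}.
Proof. by move=> NK NL x xN; apply/submod_ofP; split; [apply: NK|apply: NL]. Qed.

Lemma mem_cyclic v : v \in cyclic_sub v.
Proof. by apply/submod_ofP; exists 1; rewrite scale1r. Qed.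

Lemma cyclic_sub_le v K : v \in K -> {subset cyclic_sub v <= K}.
Proof. by move=> vK x /submod_ofP[a ->]; rewrite rpredZ. Qed.

End Lattice.

Arguments zero_sub {S M}.
Arguments sub_addl {S M K L}.
Arguments sub_addr {S M K L}.
Arguments sub_capl {S M K L}.
Arguments sub_capr {S M K L}.
Arguments zero_sub_min {S M} K.
Arguments sub_full {S M} K.


(** * Lengths of intervals of submodules *)

Section Length.
Variables (S : pzRingType) (M : lmodType S).
Implicit Types (K L N : submodClosed M) (F : nat -> submodClosed M).

Definition jump F i : bool := `[< ~ {subset F i.+1 <= F i} >].

(** An upper bound for the length of N/K. Chains are only weakly ascending and their strict steps
    are counted, so the image of a chain under a monotone map is again a chain, with no repetitions
    to remove. *)
Definition len_le K N n :=
  forall F, (forall i, {subset F i <= F i.+1}) ->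
    (forall i, {subset K <= F i} /\ {subset F i <= N}) ->
    forall k, (\sum_(i < k) jump F i <= n)%N.

Definition fin_len := exists n, len_le zero_sub (full : submodClosed M) n.

Lemma len_leW K N m n : (m <= n)%N -> len_le K N m -> len_le K N n.
Proof. by move=> mn lm F Fi FKN k; apply: leq_trans mn; apply: lm. Qed.

Lemma len_le_incl K N K' N' n : {subset K <= K'} -> {subset N' <= N} ->
  len_le K N n -> len_le K' N' n.
Proof.
move=> KK NN ln F Fi FKN; apply: ln => // i; have [FK FN] := FKN i.
by split=> x => [/KK/FK|/FN/NN].
Qed.

Lemma len_le_simple K N :
  (forall L, {subset K <= L} -> {subset L <= N} ->
     {subset L <= K} \/ {subset N <= L}) -> len_le K N 1.
Proof.
move=> sKN F Fi FKN.
(* Invariant: at most one jump has occurred, and none while [F k] is still inside [K]. *)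
suff H k : (\sum_(i < k) jump F i <= ~~ `[< {subset F k <= K} >])%N.
  by move=> k; apply: leq_trans (H k) (leq_b1 _).
elim: k => [|k IH]; first by rewrite big_ord0.
rewrite big_ord_recr /=; apply: leq_trans (leq_add IH (leqnn _)) _.
have [FK FN] := FKN k; have [FK' FN'] := FKN k.+1.
rewrite /jump; case: (sKN _ FK FN) => FkK.
  rewrite (asboolT FkK) add0n; case: asboolP => // nF.
  by case: asboolP => // F'K; case: nF => x /F'K/FK.
rewrite [in X in (_ + X)%N]asboolF ?addn0.
  case: asboolP => // FnK; case: asboolP => // F'K.
  by case: FnK => x /(Fi k)/F'K.
by case=> x /FN'/FkK.
Qed.

Lemma jump_sub F i : {subset F i.+1 <= F i} -> jump F i = false.
Proof. by move=> h; apply/asboolPn; case. Qed.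

(** Putting [K] in front of a chain that starts above [L] adds one strict step. *)
Lemma len_le_above K L N n : {subset K <= L} -> {subset L <= N} ->
  ~ {subset L <= K} -> len_le K N n -> (0 < n)%N /\ len_le L N n.-1.
Proof.
move=> KL LN nLK ln.
have H F : (forall i, {subset F i <= F i.+1}) ->
    (forall i, {subset L <= F i} /\ {subset F i <= N}) ->
    forall k, (\sum_(i < k) jump F i < n)%N.
  move=> Fi FLN k; pose G i := if i is j.+1 then F j else K.
  have Gi i : {subset G i <= G i.+1}.
    by case: i => [|i] //= x /KL xL; case: (FLN 0%N) => /(_ x xL).
  have GKN i : {subset K <= G i} /\ {subset G i <= N}.
    case: i => [|i] /=; first by split=> // x /KL/LN.
    by have [LF FN] := FLN i; split=> // x /KL/LF.
  have := ln G Gi GKN k.+1; rewrite big_ord_recl {1}/jump /= asboolT //.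
  by move=> h; apply: nLK => x xL; apply: h; case: (FLN 0%N) => /(_ x xL).
have n0 : (0 < n)%N.
  by have := H (fun=> L) (fun _ _ => id) (fun=> conj (fun _ => id) LN) 0%N; rewrite big_ord0.
by split=> // F Fi FLN k; rewrite -ltnS prednK //; apply: H.
Qed.

Lemma len_le_below K L N n : {subset K <= L} -> {subset L <= N} ->
  ~ {subset N <= L} -> len_le K N n -> (0 < n)%N /\ len_le K L n.-1.
Proof.
move=> KL LN nNL ln.
have H F : (forall i, {subset F i <= F i.+1}) ->
    (forall i, {subset K <= F i} /\ {subset F i <= L}) ->
    forall k, (\sum_(i < k) jump F i < n)%N.
  (* [G] follows [F] up to index [k] and equals [N] afterwards, which adds a strict step exactly at
     [k]. *)
  move=> Fi FKL k; pose G i := if (i <= k)%N then F i else N.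
  have Gi i : {subset G i <= G i.+1}.
    rewrite /G; case: (ltnP i k) => [ik|ki]; first by rewrite ltnW.
    by case: leqP => ik x //; have [_ FL] := FKL i; move=> xi; apply/LN/FL.
  have GKN i : {subset K <= G i} /\ {subset G i <= N}.
    rewrite /G; case: leqP => _; last by split=> // x /KL/LN.
    by have [KF FL] := FKL i; split=> // x /FL/LN.
  have := ln G Gi GKN k.+1; rewrite big_ord_recr /= {2}/jump /G ltnn leqnn.
  rewrite asboolT ?addn1; last by move=> h; apply: nNL => x xN; apply: (proj2 (FKL k)); apply: h.
  rewrite (eq_bigr (fun i : 'I_k => nat_of_bool (jump F i))) // => i _.
  by rewrite /jump ltn_ord ltnW.
have n0 : (0 < n)%N.
  by have := H (fun=> K) (fun _ _ => id) (fun=> conj (fun _ => id) KL) 0%N; rewrite big_ord0.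
by split=> // F Fi FKL k; rewrite -ltnS prednK //; apply: H.
Qed.

(** Each strict descent inside [P] lowers the length bound by one, so the descent stops after at
    most [n] steps. *)
Lemma len_le_min K N n (P : submodClosed M -> Prop) L : len_le K N n ->
  {subset K <= L} -> {subset L <= N} -> P L ->
  exists L', [/\ P L', {subset L' <= L}, {subset K <= L'} &
    forall L'', P L'' -> {subset L'' <= L'} -> {subset K <= L''} -> L'' = L'].
Proof.
move=> ln KL LN PL; have {LN ln}: len_le K L n by apply: len_le_incl ln.
elim: n L KL PL => [|n IH] L KL PL ln; last first.
  have [h|h] := pselect (forall L'', P L'' -> {subset L'' <= L} ->
      {subset K <= L''} -> L'' = L); first by exists L; split.
  have /existsNP[L1 /not_implyP[PL1 /not_implyP[L1L /not_implyP[KL1 nL]]]] := h.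
  have nLL1 : ~ {subset L <= L1} by move=> LL1; apply/nL/submod_sub_eq.
  have [_ /IH[]//] := len_le_below KL1 L1L nLL1 ln.
  move=> L' [PL' L'L KL' minL']; exists L'; split=> // x /L'L; exact: L1L.
exists L; split=> // L'' PL'' L''L KL''; apply: submod_sub_eq => //.
by apply: contrapT => nLL; have [] := len_le_below KL'' L''L nLL ln.
Qed.

Lemma len_le_max K N n (P : submodClosed M -> Prop) L : len_le K N n ->
  {subset K <= L} -> {subset L <= N} -> P L ->
  exists L', [/\ P L', {subset L <= L'}, {subset L' <= N} &
    forall L'', P L'' -> {subset L' <= L''} -> {subset L'' <= N} -> L'' = L'].
Proof.
move=> ln KL LN PL; have {KL ln}: len_le L N n by apply: len_le_incl ln.
elim: n L LN PL => [|n IH] L LN PL ln; last first.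
  have [h|h] := pselect (forall L'', P L'' -> {subset L <= L''} ->
      {subset L'' <= N} -> L'' = L); first by exists L; split.
  have /existsNP[L1 /not_implyP[PL1 /not_implyP[LL1 /not_implyP[L1N nL]]]] := h.
  have nLL1 : ~ {subset L1 <= L} by move=> L1L; apply/nL/submod_sub_eq.
  have [_ /IH[]//] := len_le_above LL1 L1N nLL1 ln.
  move=> L' [PL' LL' L'N maxL']; exists L'; split=> // x /LL1; exact: LL'.
exists L; split=> // L'' PL'' LL'' L''N; apply: submod_sub_eq => //.
by apply: contrapT => nLL; have [] := len_le_above LL'' L''N nLL ln.
Qed.

End Length.

(** If [f] and [g] together detect strict inclusions, every jump of a chain is a jump of its image
    under [f] or under [g]. Every additivity statement about lengths below is an instance. *)
Lemma len_le_transfer (S S1 S2 : pzRingType) (M : lmodType S)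
    (M1 : lmodType S1) (M2 : lmodType S2)
    (f : submodClosed M -> submodClosed M1) (g : submodClosed M -> submodClosed M2)
    (K N : submodClosed M) (K1 N1 : submodClosed M1) (K2 N2 : submodClosed M2) m n :
  (forall F : submodClosed M, {subset K <= F} -> {subset F <= N} ->
     [/\ {subset K1 <= f F}, {subset f F <= N1},
         {subset K2 <= g F} & {subset g F <= N2}]) ->
  (forall F G : submodClosed M, {subset K <= F} -> {subset G <= N} -> {subset F <= G} ->
     {subset f F <= f G} /\ {subset g F <= g G}) ->
  (forall F G : submodClosed M, {subset K <= F} -> {subset G <= N} -> {subset F <= G} ->
     {subset f G <= f F} -> {subset g G <= g F} -> {subset G <= F}) ->
  len_le K1 N1 m -> len_le K2 N2 n -> len_le K N (m + n).
Proof.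
move=> fgKN fg_homo fg_refl lm ln F Fi FKN k.
have H i : (jump F i <= jump (f \o F) i + jump (g \o F) i)%N.
  have [[KF _] [_ FN]] := (FKN i, FKN i.+1).
  rewrite /jump; case: asboolP => // nF; case: asboolP => //= /contrapT hf.
  by case: asboolP => //= /contrapT hg; case: nF; apply: fg_refl.
apply: (@leq_trans (\sum_(i < k) (jump (f \o F) i + jump (g \o F) i)))%N.
  by apply: leq_sum.
rewrite big_split leq_add //.
  apply: lm => i /=; have [KF FN] := FKN i; last by case: (fgKN _ KF FN).
  by have [] := fg_homo _ _ KF (proj2 (FKN i.+1)) (Fi i).
apply: ln => i /=; have [KF FN] := FKN i; last by case: (fgKN _ KF FN).
by have [] := fg_homo _ _ KF (proj2 (FKN i.+1)) (Fi i).
Qed.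

Lemma len_le_refl (S : pzRingType) (M : lmodType S) (K N : submodClosed M) :
  {subset N <= K} -> len_le K N 0.
Proof.
move=> NK F Fi FKN k; rewrite big1 // => i _; rewrite jump_sub // => x.
by have [_ FN] := FKN i.+1; have [KF _] := FKN i; move=> /FN/NK/KF.
Qed.

Lemma len_le_transfer1 (S S1 : pzRingType) (M : lmodType S)
    (M1 : lmodType S1) (f : submodClosed M -> submodClosed M1)
    (K N : submodClosed M) (K1 N1 : submodClosed M1) m :
  (forall F : submodClosed M, {subset K <= F} -> {subset F <= N} ->
     {subset K1 <= f F} /\ {subset f F <= N1}) ->
  (forall F G : submodClosed M, {subset K <= F} -> {subset G <= N} -> {subset F <= G} ->
     {subset f F <= f G}) ->
  (forall F G : submodClosed M, {subset K <= F} -> {subset G <= N} -> {subset F <= G} ->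
     {subset f G <= f F} -> {subset G <= F}) ->
  len_le K1 N1 m -> len_le K N m.
Proof.
move=> fKN fh fr lm; rewrite -[m]addn0.
apply: (len_le_transfer (f := f) (g := fun=> K) (K2 := K) (N2 := K) _ _ _ lm).
- by move=> F KF FN; have [h1 h2] := fKN F KF FN; split.
- by move=> F G KF GN FG; split=> //; apply: fh.
- by move=> F G KF GN FG h _; apply: fr h.
- exact: len_le_refl.
Qed.

Section Length2.
Variables (S : pzRingType) (M : lmodType S).
Implicit Types (K L N : submodClosed M) (F : nat -> submodClosed M).

(** By the modular law, nested submodules with the same intersection with [L] and the same sum with
    [L] coincide. *)
Lemma len_le_trans K L N m n : {subset K <= L} -> {subset L <= N} ->
  len_le K L m -> len_le L N n -> len_le K N (m + n).
Proof.
move=> KL LN lm ln.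
apply: (len_le_transfer (f := fun F : submodClosed M => cap_sub F L)
  (g := fun F : submodClosed M => add_sub F L) _ _ _ lm ln).
- move=> F KF FN; split; [exact: cap_sub_ge|exact: sub_capr|exact: sub_addr|].
  exact: add_sub_le.
- move=> F G _ _ FG; split.
    by apply: cap_sub_ge; [move=> x /sub_capl/FG|exact: sub_capr].
  by apply: add_sub_le; [move=> x /FG/sub_addl; apply|exact: sub_addr].
- move=> F G _ _ FG capGF addGF x xG.
  have /submod_ofP[y [z [yF zL xE]]] := addGF _ (sub_addl _ xG).
  rewrite xE rpredD //; apply: sub_capl; apply: capGF.
  apply/submod_ofP; split=> //; have -> : z = - y + x by rewrite xE addKr.
  by apply: rpredD => //; apply/submodN/FG.
Qed.

(** Composition series of an interval. They supply exact lengths, where [len_le] only bounds from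
    above. *)
Inductive cseries : submodClosed M -> submodClosed M -> nat -> Prop :=
| Cseries0 K : cseries K K 0
| CseriesS K L N n : maximal_submod K L -> cseries L N n -> cseries K N n.+1.

Lemma len_le_cseries K N n : {subset K <= N} -> len_le K N n ->
  exists2 m, (m <= n)%N & cseries K N m.
Proof.
elim: n K => [|n IH] K KN ln.
  exists 0%N => //; have -> : K = N; last exact: Cseries0.
  apply: submod_sub_eq => //; apply: contrapT => nNK.
  by have [] := len_le_below (fun _ => id) KN nNK ln.
have [NK|nNK] := pselect ({subset N <= K}).
  by exists 0%N => //; rewrite (submod_sub_eq KN NK); apply: Cseries0.
(* A minimal submodule strictly above [K] is the next term of the series. *)
have [L [nLK LN KL minL]] := len_le_min (P := fun L => ~ {subset L <= K}) ln KN (fun _ => id) nNK.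
have [_ /(IH L LN)[m mn cLN]] := len_le_above KL LN nLK ln.
exists m.+1 => //; apply: CseriesS cLN; split=> //.
  by move=> KiL; apply: nLK => x; rewrite KiL.
move=> L' KL' L'L; have [L'K|nL'K] := pselect ({subset L' <= K}).
  by left=> x; rewrite (submod_sub_eq L'K KL').
by right; rewrite (minL L').
Qed.

Lemma len_le_maximal K N : maximal_submod K N -> len_le K N 1.
Proof.
move=> [KN _ maxK]; apply: len_le_simple => L KL LN.
by case: (maxK L KL LN) => LE; [left|right] => x; rewrite LE.
Qed.

Lemma cseries_sub K N n : cseries K N n -> {subset K <= N}.
Proof. by elim=> {K N n} [K|K L N n [KL _ _] _ LN] x // xK; apply/LN/KL. Qed.

Lemma cseries_len_le K N n : cseries K N n -> len_le K N n.
Proof.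
elim=> {K N n} [K|K L N n mKL cLN IH]; first exact: len_le_refl.
have [KL _ _] := mKL.
exact: (len_le_trans KL (cseries_sub cLN) (len_le_maximal mKL) IH).
Qed.

Lemma cseriesP K N n : cseries K N n <-> exists F,
  [/\ F 0%N = K, F n = N & forall i, (i < n)%N -> maximal_submod (F i) (F i.+1)].
Proof.
split=> [|[F [F0 Fn Fi]]].
  elim=> {K N n} [K|K L N n mKL _ [F [F0 Fn Fi]]]; first by exists (fun=> K).
  exists (fun i => if i is j.+1 then F j else K); split=> // -[|i] //=; rewrite ?F0 //.
  exact: Fi.
elim: n K F F0 Fn Fi => [|n IH] K F F0 Fn Fi; first by rewrite -F0 -Fn; apply: Cseries0.
apply: (@CseriesS _ (F 1%N)); first by rewrite -F0; apply: Fi.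
by apply: (IH _ (F \o succn)) => // i ni; apply: Fi.
Qed.

Lemma has_lengthP n : has_length M n <-> cseries zero_sub (full : submodClosed M) n.
Proof.
rewrite cseriesP; split=> -[F [F0 Fn Fi]]; exists F; split=> //.
- by apply: eq_zero_sub => x; rewrite F0 => /eqP.
- by apply: eq_full => x; rewrite Fn.
- by move=> x; rewrite F0 mem_zero.
- by rewrite Fn.
Qed.

Definition serial := forall K L, {subset K <= L} \/ {subset L <= K}.

(** For finite length, a unique composition series amounts to a totally ordered lattice of
    submodules, the form used from here on. *)
Lemma uniserialP : fin_len M -> (uniserial M <-> serial).
Proof.
move=> [n ln]; split=> [[l [F [cF uF]]] K L|sM].
  (* Every submodule is a term of the unique series: glue a series from 0 to [K'] and one from [K']
     to the whole module, and compare with [F]. *)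
  have KE K' : exists2 i, (i <= l)%N & K' = F i.
    have [m _ cm] := len_le_cseries (zero_sub_min K')
      (len_le_incl (fun _ => id) (sub_full K') ln).
    have [m' _ cm'] := len_le_cseries (sub_full K')
      (len_le_incl (zero_sub_min K') (fun _ => id) ln).
    have /cseriesP[F1 [F1z F1m F1i]] := cm; have /cseriesP[F2 [F2z F2m F2i]] := cm'.
    pose G i := if (i <= m)%N then F1 i else F2 (i - m)%N.
    have [] := uF (m + m')%N G.
      split=> [x|x|i ilt]; rewrite /G /=.
      - by rewrite F1z mem_zero.
      - case: leqP => [h|_]; last by rewrite addKn F2m.
        have m'0 : m' = 0%N by apply/eqP; rewrite -leqn0 -(leq_add2l m) addn0.
        by rewrite m'0 addn0 F1m -F2z -{1}m'0 F2m.
      - case: (ltnP i m) => [im|mi]; first by rewrite ltnW //; apply: F1i.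
        case: leqP => im.
          have iE : i = m by apply/eqP; rewrite eqn_leq im.
          rewrite iE F1m -F2z subSnn; apply: F2i.
          by rewrite -(ltn_add2l m) addn0 -{1}iE.
        by rewrite subSn ?(ltnW im) //; apply: F2i; rewrite ltn_subLR // ltnW.
    move=> lE FE; exists m; first by rewrite -lE leq_addr.
    have := FE m; rewrite /G leqnn F1m => FE'; apply: submod_ext; apply: FE'.
    by rewrite -lE leq_addr.
  have Fmono i j : (i <= j <= l)%N -> {subset F i <= F j}.
    case/andP; elim: j => [|j IH] ij jl x.
      by move: ij; rewrite leqn0 => /eqP->.
    move: ij; rewrite leq_eqVlt => /predU1P[->//|]; rewrite ltnS => ij xi.
    have [_ _ /(_ j jl)[FF _ _]] := cF.
    by apply: FF; apply: IH xi => //; apply: ltnW.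
  have [[i il ->] [j jl ->]] := (KE K, KE L).
  by case: (leqP i j) => [ij|/ltnW ji]; [left|right]; apply: Fmono; rewrite ?ij ?ji.
have [m _ cm] := len_le_cseries (zero_sub_min full) ln.
have /has_lengthP[F cF] := cm; exists m, F; split=> // l' F' cF'.
(* Two series agree term by term: the next terms are comparable, and both cover the same
   submodule. *)
have H i : (i <= m)%N -> (i <= l')%N -> F' i = F i.
  elim: i => [|i IH] im il.
    by apply: submod_ext => x; case: cF => ->; case: cF' => ->.
  have {IH}Fi := IH (ltnW im) (ltnW il).
  have [_ _ /(_ i im)[FF nF mF]] := cF; have [_ _ /(_ i il)[FF' nF' mF']] := cF'.
  rewrite Fi in FF' nF' mF'; case: (sM (F' i.+1) (F i.+1)) => h.
    by case: (mF _ FF' h) => // E; [case: nF' => x; rewrite E|exact: submod_ext].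
  by case: (mF' _ FF h) => // E; [case: nF => x; rewrite E|symmetry; exact: submod_ext].
have [F0 Fm Fi] := cF; have [F'0 F'l F'i] := cF'.
suff lE : l' = m by split=> // i im; rewrite H // lE.
(* If the lengths differed, the longer series would have a proper step above the whole module. *)
have full_max K L : K =i full -> ~ maximal_submod K L.
  move=> KT [KL nKL _]; apply: nKL => x; rewrite KT.
  by apply/esym; apply: KL; rewrite KT.
case: (ltngtP l' m) => // lt; [have /full_max := Fi l' lt|have /full_max := F'i m lt]; case=> x.
  by rewrite -H // ?(ltnW lt).
by rewrite H // ?(ltnW lt).
Qed.

End Length2.

(** * Indecomposable projective modules *)

Definition linear_of (S : pzRingType) (M N : lmodType S) (f : M -> N)
    (f_lin : linear f) : {linear M -> N} :=
  HB.pack f (GRing.isLinear.Build _ _ _ _ f f_lin).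

Section LinearImages.
Variables (S : pzRingType) (M N : lmodType S) (f : {linear M -> N}).

Lemma preim_closed (L : submodClosed N) : closed_prop (fun x => f x \in L).
Proof.
by split=> [|a u v uL vL]; rewrite ?linear0 ?rpred0 // linearP rpredD ?rpredZ.
Qed.
Definition preim_sub L := submod_of (preim_closed L).

Lemma mem_preim L x : (x \in preim_sub L) = (f x \in L).
Proof. by apply/idP/idP => [/submod_ofP//|fx]; apply/submod_ofP. Qed.

Lemma img_closed (K : submodClosed M) :
  closed_prop (fun y => exists2 x, x \in K & y = f x).
Proof.
split=> [|a _ _ [x xK ->] [y yK ->]]; first by exists 0; rewrite ?rpred0 ?linear0.
by exists (a *: x + y); rewrite ?linearP // rpredD ?rpredZ.
Qed.
Definition img_sub K := submod_of (img_closed K).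

Lemma finitely_generated_img : (forall y, exists x, f x = y) ->
  finitely_generated M -> finitely_generated N.
Proof.
move=> fonto [n [g gen]]; exists n, (f \o g) => y.
have [x <-] := fonto y; have [a ->] := gen x; exists a.
by rewrite linear_sum; apply: eq_bigr => i _; rewrite linearZ.
Qed.

Lemma fin_len_img : (forall y, exists x, f x = y) -> fin_len M -> fin_len N.
Proof.
move=> fonto [n ln]; exists n; apply: (len_le_transfer1 (f := preim_sub) _ _ _ ln).
- by move=> F _ _; split=> //; apply: zero_sub_min.
- by move=> F G _ _ FG x; rewrite !mem_preim; apply: FG.
- move=> F G _ _ _ GF y; have [x <-] := fonto y.
  by rewrite -!mem_preim; apply: GF.
Qed.

End LinearImages.

Section Quotient.
Variables (S : pzRingType) (M : lmodType S) (N : submodClosed M).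

Definition quot_map (x : M) : quot_mod N := \pi_(quot_mod N)%qT x.

Lemma quot_map_linear : linear quot_map.
Proof.
move=> a x y; rewrite /quot_map quot_piD; congr (_ + _).
exact/esym/quot_scaleE.
Qed.
HB.instance Definition _ := GRing.isLinear.Build S M (quot_mod N) _ quot_map
  quot_map_linear.

Lemma quot_map_onto y : exists x, quot_map x = y.
Proof. by exists (repr y); rewrite /quot_map reprK. Qed.

Lemma quot_map_eq x y : quot_map x = quot_map y <-> x - y \in N.
Proof. exact: (rwP (quot_eqP N x y)). Qed.

Lemma quot_map_eq0 x : quot_map x = 0 <-> x \in N.
Proof. by rewrite -(linear0 quot_map) quot_map_eq subr0. Qed.

Lemma mem_img_quot (K : submodClosed M) x : {subset N <= K} ->
  quot_map x \in img_sub quot_map K <-> x \in K.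
Proof.
move=> NK; split=> [/submod_ofP[y yK /quot_map_eq/NK xyK]|xK].
  by rewrite -(subrK y x) rpredD.
by apply/submod_ofP; exists x.
Qed.

Lemma serial_quotP : serial (quot_mod N) <->
  forall K L : submodClosed M, {subset N <= K} -> {subset N <= L} ->
    {subset K <= L} \/ {subset L <= K}.
Proof.
split=> [sq K L NK NL|sN K L].
  case: (sq (img_sub quot_map K) (img_sub quot_map L)) => h; [left|right] => x xK.
    by apply/(mem_img_quot _ NL)/h/mem_img_quot.
  by apply/(mem_img_quot _ NK)/h/mem_img_quot.
have Npre (K' : submodClosed (quot_mod N)) : {subset N <= preim_sub quot_map K'}.
  by move=> x /quot_map_eq0 x0; rewrite mem_preim /= x0 rpred0.
case: (sN _ _ (Npre K) (Npre L)) => h; [left|right] => y; have [x <-] := quot_map_onto y.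
  by rewrite -!mem_preim; apply: h.
by rewrite -!mem_preim; apply: h.
Qed.

End Quotient.

(** * Fitting's lemma *)

Section Fitting.
Variables (S : pzRingType) (M : lmodType S) (f : {linear M -> M}).

Lemma iter_linear n : linear (iter n f).
Proof. by elim: n => [|n IH] a x y //=; rewrite IH linearP. Qed.

Lemma iter_lin0 n : iter n f 0 = 0.
Proof. by elim: n => //= n ->; rewrite linear0. Qed.

Lemma kiter_closed n : closed_prop (fun x => iter n f x = 0).
Proof.
split=> [|a u v u0 v0]; first exact: iter_lin0.
by rewrite iter_linear u0 v0 scaler0 addr0.
Qed.

Lemma iiter_closed n : closed_prop (fun x => exists y, x = iter n f y).
Proof.
split=> [|a _ _ [y ->] [z ->]]; first by exists 0; rewrite iter_lin0.
by exists (a *: y + z); rewrite iter_linear.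
Qed.

(** The kernels and images of the powers of [f] stabilise, and then M is the direct sum of a kernel
    and an image. The exponent is a successor so that an onto power can be read as [f] applied to
    something. *)
Lemma fitting : fin_len M -> indecomposable M ->
  exists n, (forall x, iter n.+1 f x = 0) \/ (forall x, exists y, x = iter n.+1 f y).
Proof.
move=> [l ln] [_ indM].
pose I n := submod_of (iiter_closed n); pose K n := submod_of (kiter_closed n).
have II m n : {subset I (m + n)%N <= I m}.
  move=> _ /submod_ofP[y ->]; apply/submod_ofP; exists (iter n f y).
  by rewrite -iterD.
have KK m n : {subset K m <= K (m + n)%N}.
  move=> x /submod_ofP x0; apply/submod_ofP.
  by rewrite addnC iterD x0 iter_lin0.
have [_ [[i ->] _ _ minI]] := len_le_min (P := fun L => exists n, L = I n) ln
  (zero_sub_min _) (sub_full (I 0%N)) (ex_intro _ 0%N erefl).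
have [_ [[k ->] _ _ maxK]] := len_le_max (P := fun L => exists n, L = K n) ln
  (zero_sub_min _) (sub_full (K 0%N)) (ex_intro _ 0%N erefl).
have IE n : I (i + n)%N = I i by apply: minI (zero_sub_min _) => //; exists (i + n)%N.
have KE n : K (k + n)%N = K k by apply: maxK (sub_full _) => //; exists (k + n)%N.
(* Beyond [p] both sequences are constant, so passing from exponent [p.+1] to its double changes
   neither kernel nor image. *)
pose p := (i + k)%N; exists p.
have I2 : I (p.+1 + p.+1)%N = I p.+1 by rewrite /p -!addnS -!addnA !IE.
have K2 : K (p.+1 + p.+1)%N = K p.+1 by rewrite /p [(i + k)%N]addnC -!addnS -!addnA !KE.
have decM x : exists y z, [/\ y \in K p.+1, z \in I p.+1 & x = y + z].
  have : iter p.+1 f x \in I (p.+1 + p.+1)%N by rewrite I2; apply/submod_ofP; exists x.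
  move=> /submod_ofP[y xy]; exists (x - iter p.+1 f y), (iter p.+1 f y).
  split; last by rewrite subrK.
    apply/submod_ofP; rewrite addrC -scaleN1r iter_linear scaleN1r xy.
    by rewrite iterD addNr.
  by apply/submod_ofP; exists y.
case: (indM (K p.+1) (I p.+1)) => // [x /submod_ofP x0 /submod_ofP[y xE]|K0|I0].
- have : y \in K (p.+1 + p.+1)%N by apply/submod_ofP; rewrite iterD -xE.
  by rewrite K2 => /submod_ofP; rewrite -xE.
- right=> x; have [y [z [+ /submod_ofP zI ->]]] := decM x.
  by rewrite K0 => /eqP->; rewrite add0r.
- left=> x; apply/eqP; rewrite -[_ == 0]I0; apply/submod_ofP.
  by exists x.
Qed.

End Fitting.

(* Lifting M -> M / L along a free cover of a complement K gives an endomorphism f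
   with image in K and f = id modulo L; by Fitting, f is onto or nilpotent. *)
Lemma hollow_projective (S : pzRingType) (M : lmodType S) (K L : submodClosed M) :
  finitely_generated M -> fin_len M -> indecomposable M -> projective_module M ->
  (forall x, exists y z, [/\ y \in K, z \in L & x = y + z]) ->
  (forall x, x \in K) \/ (forall x, x \in L).
Proof.
move=> fgM lM indM projM KL; have [n [g gen]] := fgM.
have /choice[y yP] i : exists y, y \in K /\ g i - y \in L.
  have [y [z [yK zL gE]]] := KL (g i); exists y; split=> //.
  by rewrite gE addrC addKr.
pose s (a : 'rV[S]_n) : M := \sum_i a 0 i *: y i.
have s_lin : linear s.
  move=> c a b; rewrite /s scaler_sumr -big_split; apply: eq_bigr => i _ /=.
  by rewrite !mxE scalerDl scalerA.
pose sL : {linear 'rV[S]_n -> M} := linear_of s_lin.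
have fg_rV : finitely_generated 'rV[S]_n.
  by exists n, (delta_mx 0) => a; exists (a 0); apply: row_sum_delta.
have qs_onto y' : exists a, (quot_map L \o sL) a = y'.
  have [x <-] := quot_map_onto y'; have [a ->] := gen x.
  exists (\row_i a i); apply/quot_map_eq; rewrite /= /s -sumrB.
  apply: rpred_sum => i _; rewrite mxE -scalerBr rpredZ //.
  by rewrite -opprB; apply: submodN; have [] := yP i.
have [k kP] := projM _ _ (quot_map L \o sL) (quot_map L) fg_rV
  (finitely_generated_img (@quot_map_onto _ _ L) fgM) qs_onto.
have [p [f0|fonto]] := fitting (sL \o k) lM indM.
- right=> x; suff H i : x - iter i (sL \o k) x \in L by have := H p.+1; rewrite f0 subr0.
  elim: i => [|i IH]; first by rewrite subrr rpred0.
  rewrite -(subrKA (iter i (sL \o k) x)) rpredD // iterS -opprB; apply: submodN.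
  by apply/quot_map_eq/kP.
- left=> x; have [z ->] := fonto x; rewrite iterS /= /s.
  by apply: rpred_sum => i _; rewrite rpredZ //; have [] := yP i.
Qed.

(** * Modules all of whose proper quotients are serial *)

Section TwoFactor.
Variables (S : pzRingType) (M : lmodType S).
Implicit Types (K L N X Y : submodClosed M).

(** A submodule between [K] and [K + X] is determined by its intersection with the simple [X], which
    is 0 or [X]. *)
Lemma maximal_add_simple K X :
  maximal_submod zero_sub X -> (forall x, x \in K -> x \in X -> x = 0) ->
  maximal_submod K (add_sub K X).
Proof.
move=> [_ X0 simX] KX; split=> [|KE|L KL LKX]; first exact: sub_addl.
  apply: X0 => x; rewrite mem_zero; apply/eqP/idP => [->|xX]; first exact: rpred0.
  by apply: KX => //; rewrite KE; apply: sub_addr.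
case: (simX (cap_sub L X)) => [||E|E]; [exact: zero_sub_min|exact: sub_capr|left|right] => x.
  apply/idP/idP => [xL|/KL//]; have /submod_ofP[y [z [yK zX xE]]] := LKX x xL.
  have : z \in cap_sub L X.
    apply/submod_ofP; split=> //; rewrite (_ : z = x - y); first by apply: submodB => //; apply: KL.
    by rewrite xE addrC addKr.
  by rewrite E mem_zero => /eqP z0; rewrite xE z0 addr0.
apply/idP/idP => [/LKX//|]; apply: add_sub_le => // y yX.
by apply: (@sub_capl _ _ L X); rewrite E.
Qed.

Lemma exists_simple X : fin_len M -> ~ X =i pred1 0 ->
  exists2 Y : submodClosed M, {subset Y <= X} & maximal_submod zero_sub Y.
Proof.
move=> [n ln] X0.
have [Y [Y0 YX _ minY]] := len_le_min (P := fun L => ~ {subset L <= zero_sub}) ln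
  (zero_sub_min X) (sub_full X)
  (fun h => X0 (fun x => etrans (congr1 (fun L => x \in L)
     (submod_sub_eq h (zero_sub_min X))) (mem_zero x))).
exists Y => //; split=> [|E|L _ LY]; [exact: zero_sub_min|by apply: Y0 => x; rewrite E|].
have [L0|L0] := pselect ({subset L <= zero_sub}).
  by left=> x; rewrite (submod_sub_eq L0 (zero_sub_min _)).
by right; rewrite (minY L L0 LY (zero_sub_min L)).
Qed.

(** The last hypothesis says that M/N is serial for every nonzero [N]. With [T] the sum of two
    distinct simple submodules, the radical series descends a chain from M to [T] and then drops to
    0. *)
Lemma factor_serial2_of_quot : fin_len M -> ~ serial M ->
  (forall N K L : submodClosed M, ~ N =i pred1 0 -> {subset N <= K} -> {subset N <= L} ->
     {subset K <= L} \/ {subset L <= K}) ->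
  factor_serial2 M.
Proof.
move=> lM nsM chM.
have [K [L nKL]] : exists K L, ~ ({subset K <= L} \/ {subset L <= K}).
  by move/existsNP: nsM => [K /existsNP[L h]]; exists K, L.
have KL0 x : x \in K -> x \in L -> x = 0.
  move=> xK xL; apply: contrapT => x0; apply: nKL.
  apply: (chM (cyclic_sub x)) => [E||]; [|exact: cyclic_sub_le|exact: cyclic_sub_le].
  by apply/x0/eqP; rewrite -[_ == 0]E mem_cyclic.
have [S1 S1K sS1] : exists2 Y : submodClosed M, {subset Y <= K} & maximal_submod zero_sub Y.
  apply: exists_simple => // K0; apply: nKL; left=> x; rewrite K0 => /eqP->.
  exact: rpred0.
have [S2 S2L sS2] : exists2 Y : submodClosed M, {subset Y <= L} & maximal_submod zero_sub Y.
  apply: exists_simple => // L0; apply: nKL; right=> x; rewrite L0 => /eqP->.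
  exact: rpred0.
have S12 x : x \in S1 -> x \in S2 -> x = 0 by move=> /S1K xK /S2L; apply: KL0.
have nz Y : maximal_submod zero_sub Y -> ~ Y =i pred1 0.
  by move=> [_ nY _] Y0; apply: nY => x; rewrite Y0 mem_zero.
pose T := add_sub S1 S2.
have T0 : ~ T =i pred1 0.
  move=> T0; apply: (nz _ sS1) => y; apply/idP/eqP => [yS|->]; last exact: rpred0.
  by apply/eqP; rewrite -[_ == 0]T0; apply: sub_addl.
have mT1 : maximal_submod S1 T := maximal_add_simple sS2 S12.
have mT2 : maximal_submod S2 T.
  have -> : T = add_sub S2 S1.
    by apply: submod_sub_eq; apply: add_sub_le; do ?[exact: sub_addl|exact: sub_addr].
  by apply: maximal_add_simple => // x xS2 xS1; apply: S12.
(* A nonzero [X] contains a simple [Y]. Either [Y] meets [S1] and lies in it, or [S1 + Y] and [T]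
   both cover [S1] and coincide, as submodules above [S1] form a chain. So [Y] lies in both [X] and
   [T], which are therefore comparable. *)
have compT X : {subset X <= T} \/ {subset T <= X}.
  have [X0|X0] := pselect (X =i pred1 0).
    by left=> x; rewrite X0 => /eqP->; apply: rpred0.
  have [Y YX sY] := exists_simple lM X0.
  apply: (chM _ _ _ (nz _ sY) YX).
  have [Y1|Y1] := pselect (exists2 x, x \in Y & x \in S1 /\ x <> 0).
    have [x xY [xS1 x0]] := Y1; have [_ _ /(_ (cap_sub Y S1))] := sY.
    case=> [||E|E]; [exact: zero_sub_min|exact: sub_capl| |].
      case: x0; apply/eqP; rewrite -mem_zero -E; exact/submod_ofP.
    by move=> y; rewrite -E => /sub_capr yS1; apply: sub_addl.
  have mY : maximal_submod S1 (add_sub S1 Y).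
    apply: maximal_add_simple => // x xS1 xY; apply: contrapT => x0.
    by apply: Y1; exists x.
  have [S1T nST _] := mT1; have [S1Y _ maxY] := mY.
  case: (chM S1 T (add_sub S1 Y) (nz _ sS1)) => // h.
    case: (maxY T) => // E; first by case: nST => x; rewrite E.
    by move=> x xY; rewrite E; apply: sub_addr.
  by move=> x xY; apply: h; apply: sub_addr.
have [n ln] := lM.
have [m _ cm] := len_le_cseries (sub_full T) (len_le_incl (zero_sub_min T) (fun _ => id) ln).
have /cseriesP[U [U0 Um Ui]] := cm.
have TU i : (i <= m)%N -> {subset T <= U i}.
  elim: i => [|i IH] im x xT; first by rewrite U0.
  by have [UU _ _] := Ui i im; apply: UU; apply: IH => //; apply: ltnW.
(* [U i] is the only maximal submodule of [U i.+1]: a maximal [X] is either inside [T], hence inside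
   [U i], or above [T], where submodules form a chain. *)
have radU i : (i < m)%N -> Defs.rad (U i.+1) = U i.
  move=> im; have [UU nUU maxU] := Ui i im.
  have TUi : {subset T <= U i} by apply: TU; apply: ltnW.
  apply: submod_ext => x; apply/idP/idP => [/asboolP[_ /(_ _ (Ui i im))]//|xU].
  apply/asboolP; split=> [|X [XU nXU maxX]]; first exact: UU.
  have {}TX : {subset X <= U i} -> x \in X.
    by move=> h; case: (maxX (U i)) => // E; rewrite -E.
  case: (compT X) => [XT|TX']; first by apply: TX => y /XT/TUi.
  case: (chM T X (U i)) => // UX; exact: UX.
have rad_iterE i : (i <= m)%N -> rad_iter M i = U (m - i)%N.
  elim: i => [|i IH] im; first by rewrite subn0 Um.
  rewrite /rad_iter iterS -/(rad_iter M i) IH ?(ltnW im) //.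
  by rewrite -(subnSK im) radU // ltn_subrL (leq_trans _ im).
(* [T] has the maximal submodules [S1] and [S2], which meet in 0. *)
have rad0 : rad_iter M m.+1 = zero_sub.
  rewrite /rad_iter iterS -/(rad_iter M m) rad_iterE // subnn U0.
  by apply: eq_zero_sub => x /asboolP[_ h]; apply: S12; apply: h.
(* [m] factors above [T] and two inside it: the two quotients to examine are M/T and M/0. *)
exists m.+2; split=> //.
- by apply/has_lengthP; apply: CseriesS sS1 (CseriesS mT1 cm).
- rewrite subSS subSS subn0 rad_iterE // subnn U0.
  apply/uniserialP; first exact: (fin_len_img (@quot_map_onto _ _ T) lM).
  apply/serial_quotP => X Y TX TY; exact: (chM T).
- rewrite subSS subn0 rad0.
  move/(uniserialP (fin_len_img (@quot_map_onto _ _ zero_sub) lM))/serial_quotP => h.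
  by apply: nKL; apply: h; apply: zero_sub_min.
Qed.

End TwoFactor.

Section NonprojectiveUniserial.
Variable S : pzRingType.
Hypothesis fg_fin_len : forall M : lmodType S, finitely_generated M -> fin_len M.
Hypothesis nonproj_uniserial : forall M : lmodType S, finitely_generated M ->
  indecomposable M -> ~ projective_module M -> uniserial M.

Lemma indecomposable_factor_serial (M : lmodType S) :
  finitely_generated M -> indecomposable M -> uniserial M \/ factor_serial2 M.
Proof.
move=> fgM indM; have lM := fg_fin_len fgM.
have [projM|nprojM] := pselect (projective_module M); last by left; apply: nonproj_uniserial.
have [sM|nsM] := pselect (serial M); first by left; apply/uniserialP.
right; apply: factor_serial2_of_quot => // N K L N0 NK NL.
have [NT|NT] := pselect (forall x, x \in N); first by left=> x _; apply: NL.
have lQ := fin_len_img (@quot_map_onto _ _ N) lM.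
have fgQ := finitely_generated_img (@quot_map_onto _ _ N) fgM.
suff : uniserial (quot_mod N) by move=> /(uniserialP lQ)/serial_quotP; apply.
apply: nonproj_uniserial => //.
  split.
    have /existsNP[x xN] := NT; exists (quot_map N x).
    by apply/eqP => /quot_map_eq0.
  move=> K' L' KL0 KLT.
  (* A decomposition of M/N pulls back to two submodules with sum M; one of them is M itself, which
     forces the other summand to vanish. *)
  have [] := hollow_projective (K := preim_sub (quot_map N) K')
    (L := preim_sub (quot_map N) L') fgM lM indM projM.
  - move=> x; have [y' [z' [yK zL xE]]] := KLT (quot_map N x).
    have [y yE] := quot_map_onto y'; exists y, (x - y).
    split; [by rewrite mem_preim /= yE| |by rewrite addrC subrK].
    by rewrite mem_preim linearB /= xE yE addrC addKr.
  - move=> KT; right=> y; apply/idP/eqP => [yL|->]; last exact: rpred0.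
    by apply: KL0 => //; have [x xE] := quot_map_onto y; move: (KT x); rewrite mem_preim /= xE.
  - move=> LT; left=> y; apply/idP/eqP => [yL|->]; last exact: rpred0.
    by apply: KL0 => //; have [x xE] := quot_map_onto y; move: (LT x); rewrite mem_preim /= xE.
(* If M/N were projective, the quotient map would split and [N] would be a proper nonzero direct
   summand of M. *)
move=> projQ.
have [k kP] := projQ M (quot_mod N) (quot_map N) idfun fgM fgQ (@quot_map_onto _ _ N).
have [_ /(_ (img_sub k full) N)[]//] := indM.
- by move=> _ /submod_ofP[q _ ->] /quot_map_eq0; rewrite kP /= => ->; rewrite linear0.
- move=> x; exists (k (quot_map N x)), (x - k (quot_map N x)).
  split; [by apply/submod_ofP; exists (quot_map N x)| |by rewrite addrC subrK].
  by apply/quot_map_eq0; rewrite linearB /= kP subrr.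
- move=> k0; apply: NT => x; apply/quot_map_eq0; rewrite -[quot_map N x]kP /=.
  have : k (quot_map N x) \in img_sub k full by apply/submod_ofP; exists (quot_map N x).
  by rewrite k0 => /eqP->; rewrite linear0.
Qed.

Lemma uniserial_or_two_Nakayama :
  (forall M : lmodType S, finitely_generated M -> indecomposable M -> uniserial M) \/
  two_Nakayama S.
Proof.
have [[M ME]|nM] := pselect (exists M : lmodType S,
    [/\ finitely_generated M, indecomposable M & factor_serial2 M]).
  right; split=> [N fgN indN|]; last by exists M.
  have [uN|] := indecomposable_factor_serial fgN indN; last by right.
  by left; split=> //; case: indN.
left=> M fgM indM; have [//|f2] := indecomposable_factor_serial fgM indM.
by case: nM; exists M.
Qed.

End NonprojectiveUniserial.

(** * Modules over commutative artinian rings *)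

Section LengthMaps.
Variables (S : pzRingType) (M : lmodType S).

Lemma len_le_ker_img (N : lmodType S) (f : {linear M -> N}) (K : submodClosed M) m n :
  len_le zero_sub (cap_sub K (preim_sub f zero_sub)) m ->
  len_le zero_sub (img_sub f K) n -> len_le zero_sub K (m + n).
Proof.
move=> lm ln.
apply: (len_le_transfer (f := fun F : submodClosed M => cap_sub F (preim_sub f zero_sub))
  (g := img_sub f) _ _ _ lm ln).
- move=> F _ FK; split; [exact: zero_sub_min| |exact: zero_sub_min|].
    by apply: cap_sub_ge; [move=> x /sub_capl/FK|exact: sub_capr].
  by move=> _ /submod_ofP[x /FK xK ->]; apply/submod_ofP; exists x.
- move=> F G _ _ FG; split.
    by apply: cap_sub_ge; [move=> x /sub_capl/FG|exact: sub_capr].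
  by move=> _ /submod_ofP[x /FG xG ->]; apply/submod_ofP; exists x.
- move=> F G _ _ FG kerGF imgGF x xG.
  have /submod_ofP[y yF fxy] : f x \in img_sub f F.
    by apply: imgGF; apply/submod_ofP; exists x.
  rewrite -(subrK y x) rpredD //; apply: sub_capl; apply: kerGF.
  apply/submod_ofP; split; first by apply: submodB => //; apply: FG.
  by rewrite mem_preim linearB /= fxy subrr mem_zero.
Qed.

Lemma scale_vec_linear (v : M) : linear (fun r : S^o => (r : S) *: v).
Proof. by move=> a x y; rewrite scalerDl -scalerA. Qed.
Definition scale_vec (v : M) := linear_of (scale_vec_linear v).

(** The interval is compared with the left ideals of S by sending F to the set of r with r v in
    F. *)
Lemma len_le_add_cyclic (K : submodClosed M) v l :
  len_le zero_sub (full : submodClosed S^o) l -> len_le K (add_sub K (cyclic_sub v)) l.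
Proof.
apply: (len_le_transfer1 (f := preim_sub (scale_vec v))).
- by move=> F _ _; split=> //; apply: zero_sub_min.
- by move=> F G _ _ FG r; rewrite !mem_preim; apply: FG.
- move=> F G KF GKv FG h x xG.
  have /submod_ofP[y [_ [yK /submod_ofP[r ->] xE]]] := GKv x xG.
  rewrite xE; apply: rpredD; first exact: KF.
  have /h : (r : S^o) \in preim_sub (scale_vec v) G; last by rewrite mem_preim.
  rewrite mem_preim /= (_ : r *: v = x - y); last by rewrite xE addrC addKr.
  by apply: submodB => //; apply/FG/KF.
Qed.

Lemma fin_len_family (I : finType) (g : I -> M) : fin_len S^o ->
  exists2 K : submodClosed M, exists n, len_le zero_sub K n & forall i, g i \in K.
Proof.
move=> [l ll].
suff [K lK gK] : exists2 K : submodClosed M, exists n, len_le zero_sub K n &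
    forall i, i \in enum I -> g i \in K.
  by exists K => // i; apply: gK; rewrite mem_enum.
elim: (enum I) => [|i s [K [n ln] gK]].
  by exists zero_sub => //; exists 0%N; apply: len_le_refl.
exists (add_sub K (cyclic_sub (g i))).
  exists (n + l)%N.
  exact: (len_le_trans (zero_sub_min K) sub_addl ln (len_le_add_cyclic ll)).
move=> j; rewrite inE => /predU1P[->|/gK]; last exact: sub_addl.
by apply: sub_addr; apply: mem_cyclic.
Qed.

End LengthMaps.

(** Without a minimal member, dependent choice builds an infinite strictly descending chain. *)
Lemma artinian_min (S : pzRingType) (M : lmodType S) (P : submodClosed M -> Prop) L :
  artinian_module M -> P L ->
  exists L', P L' /\ forall L'', P L'' -> {subset L'' <= L'} -> L'' = L'.
Proof.
move=> artM PL; apply: contrapT => nmin.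
pose X := {L : submodClosed M | P L}.
have next (L1 : X) : {L2 : X | {subset sval L2 <= sval L1} /\ sval L2 <> sval L1}.
  apply: cid; case: L1 => L1 PL1; apply: contrapT => h; apply: nmin.
  exists L1; split=> // L2 PL2 L21; apply: contrapT => L2n; apply: h.
  by exists (exist _ L2 PL2).
have [F [_ FS]] := dependent_choice next (exist _ L PL).
have [n Fn] := artM (fun n => sval (F n)) (fun n => proj1 (FS n)).
have [_] := FS n; apply; apply: submod_ext; exact: Fn.
Qed.

(** * Commutative artinian rings have finite length *)

Section Hopkins.
Variable R : comPzRingType.
Implicit Types (I J W L : submodClosed R^o).

Let finl I := exists n, len_le zero_sub I n.

(* Let W be minimal among the ideals of infinite length.  Each r acts on W as 0
   or surjectively, else kernel and image would have finite length; by the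
   chain (r ^+ n) it is then even invertible on W.  So W behaves as a vector
   space, and a hyperplane of W has finite length, a contradiction. *)
Lemma hopkins : artinian_module R^o -> fin_len R^o.
Proof.
move=> artR; apply: contrapT => nfinR.
have [W [nfinW minW]] := artinian_min (P := fun I => ~ finl I) artR nfinR.
have subW I : {subset I <= W} -> ~ {subset W <= I} -> finl I.
  move=> IW nWI; apply: contrapT => nfinI; apply: nWI => x.
  by rewrite (minW I).
have [w wW w0] : exists2 w, w \in W & w <> 0.
  apply: contrapT => h; apply: nfinW; exists 0%N; apply: len_le_refl => x xW.
  by rewrite mem_zero; apply/eqP; apply: contrapT => x0; apply: h; exists x.
pose m r : {linear R^o -> R^o} := *:%R r.
have mulW r : (exists2 x, x \in W & r * x <> 0) ->
    forall x, x \in W -> exists2 y, y \in W & x = r * y.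
  move=> [y yW ry0]; suff WrW : {subset W <= img_sub (m r) W}.
    by move=> x /WrW/submod_ofP.
  apply: contrapT => nWrW.
  have [a la] : finl (cap_sub W (preim_sub (m r) zero_sub)).
    apply: subW; first exact: sub_capl.
    move=> /(_ y yW)/sub_capr; rewrite mem_preim mem_zero /= => /eqP; exact: ry0.
  have [b lb] : finl (img_sub (m r) W).
    by apply: subW => // _ /submod_ofP[x xW ->]; rewrite rpredZ.
  by apply: nfinW; exists (a + b)%N; apply: len_le_ker_img la lb.
have invW r : (exists2 x, x \in W & r * x <> 0) ->
    exists s, forall x, x \in W -> s * r * x = x.
  (* The chain yields [s] with r^n = s r^(n+1). Since r^n maps W onto itself, s r is the identity on
     W. *)
  move=> rW; pose F n : submodClosed R^o := cyclic_sub (r ^+ n : R^o).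
  have Fn n : {subset F n.+1 <= F n}.
    by apply: cyclic_sub_le; apply/submod_ofP; exists r; apply: exprS.
  have [n] := artR F Fn; move=> /(_ n.+1 (leqnSn n) (r ^+ n)).
  rewrite mem_cyclic => /submod_ofP[s rs].
  exists s => x xW.
  have [y yW ->] : exists2 y, y \in W & x = r ^+ n * y.
    elim: {rs} n => [|n IH]; first by exists x; rewrite ?expr0 ?mul1r.
    have [y yW ->] := IH; have [z zW ->] := mulW r rW y yW.
    by exists z; rewrite // exprSr mulrA.
  by rewrite mulrA -(mulrA s) -exprS -[s * _]rs.
(* [P] does not ask for 0, so that the union of the empty chain satisfies it; [L] puts 0 back. *)
pose P (A : set R) := [/\ (forall x, A x -> x \in W), ~ A w &
  forall a u v, A u -> A v -> A (a * u + v)].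
have [A [[AW nAw Alin] maxA]] : exists A, P A /\ forall B, (A `<` B)%classic -> ~ P B.
  apply: Zorn_bigcup => F FP totF; split=> [x [B FB Bx]|[B FB Bw]|].
  - by have [+ _ _] := FP B FB; apply.
  - by have [_ + _] := FP B FB; apply.
  - move=> a u v [B FB Bu] [C FC Cv]; have [BC|CB] := totF B C FB FC.
      by exists C => //; have [_ _ +] := FP C FC; apply=> //; apply: BC.
    by exists B => //; have [_ _ +] := FP B FB; apply=> //; apply: CB.
have max_mem I : (forall x, A x -> x \in I) -> {subset I <= W} -> ~~ (w \in I) ->
    forall x, x \in I -> A x.
  move=> AI IW wI; apply: contrapT => nIA; apply: (maxA (fun x => x \in I)).
    by split=> // h; apply: nIA.
  by split=> //; [exact/negP|exact: (GRing.submodClosedP I).2].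
have L_closed : closed_prop (fun x : R^o => x = 0 \/ A x).
  split=> [|a u v]; first by left.
  move=> [->|Au] [->|Av].
  - by left; rewrite scaler0 addr0.
  - by right; rewrite scaler0 add0r.
  - have A0 : A 0 by have := Alin (-1) u u Au Au; rewrite mulN1r addNr.
    by right; apply: Alin.
  - by right; apply: Alin.
pose L := submod_of L_closed.
have wL : w \notin L by apply/negP => /submod_ofP[].
have LW : {subset L <= W}.
  by move=> x /submod_ofP[->|/AW//]; apply: rpred0.
have maxL I : {subset L <= I} -> {subset I <= W} -> w \notin I -> {subset I <= L}.
  move=> LI IW wI x xI; apply/submod_ofP; right; apply: max_mem xI => // y Ay.
  by apply: LI; apply/submod_ofP; right.
have [a la] : finl L by apply: subW => // WL; move/negP: wL; apply; apply: WL.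
(* W/L is simple: for [u] in W outside [L], maximality gives w = l + r u, and [r] is invertible on
   W, so any [I] containing [L] and [w] contains [u]. *)
have l1 : len_le L W 1.
  apply: len_le_simple => I LI IW; have [wI|wI] := boolP (w \in I); last by left; apply: maxL.
  right=> u uW; have [/LI//|uL] := boolP (u \in L).
  have /submod_ofP[l [_ [lL /submod_ofP[r ->] wE]]] : w \in add_sub L (cyclic_sub u).
    apply: contrapT => /negP wLu; move/negP: uL; apply.
    apply: (maxL _ sub_addl _ wLu); last by apply: sub_addr; apply: mem_cyclic.
    by apply: add_sub_le => //; apply: cyclic_sub_le.
  have ru0 : r * u <> 0.
    by move=> ru0; move/negP: wL; apply; rewrite wE /= [r *: u]ru0 addr0.
  have [s sr] := invW r (ex_intro2 _ _ u uW ru0).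
  rewrite -(sr u uW) -mulrA; apply: (rpredZ s); rewrite (_ : r * u = w - l).
    by apply: submodB => //; apply: LI.
  by rewrite wE addrC addKr.
apply: nfinW; exists (a + 1)%N; exact: (len_le_trans (zero_sub_min L) LW la l1).
Qed.

End Hopkins.

(** A synonym of the carrier, so that the R-action through [rho] and the S-action do not compete for
    the same type. *)
Definition restr (R : comPzRingType) (S : pzRingType) (rho : {rmorphism R -> S})
  (M : lmodType S) : Type := M.

Section Restriction.
Variables (R : comPzRingType) (S : pzRingType) (rho : {rmorphism R -> S}).

Section Structure.
Variable M : lmodType S.
HB.instance Definition _ := GRing.Zmodule.on (restr rho M).

Definition restr_scale (r : R) (x : restr rho M) : restr rho M := rho r *: (x : M).

Fact restr_scalerA a b x : restr_scale a (restr_scale b x) = restr_scale (a * b) x.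
Proof. by rewrite /restr_scale scalerA rmorphM. Qed.
Fact restr_scale1r : left_id 1 restr_scale.
Proof. by move=> x; rewrite /restr_scale rmorph1 scale1r. Qed.
Fact restr_scalerDr : right_distributive restr_scale +%R.
Proof. by move=> a x y; apply: scalerDr. Qed.
Fact restr_scalerDl x : {morph restr_scale^~ x : a b / a + b}.
Proof. by move=> a b; rewrite /restr_scale rmorphD; apply: scalerDl. Qed.
HB.instance Definition _ := GRing.Zmodule_isLmodule.Build R (restr rho M)
  restr_scalerA restr_scale1r restr_scalerDr restr_scalerDl.

Lemma restr_scaleE r (x : restr rho M) : r *: x = rho r *: (x : M).
Proof. by []. Qed.

Lemma restr_sub_closed (K : submodClosed M) :
  closed_prop (fun x : restr rho M => (x : M) \in K).
Proof.
split=> [|a u v uK vK]; first exact: (GRing.submodClosedP K).1.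
exact: (GRing.submodClosedP K).2.
Qed.
Definition restr_sub K := submod_of (restr_sub_closed K).

Lemma fin_len_restr : fin_len (restr rho M) -> fin_len M.
Proof.
move=> [n ln]; exists n; apply: (len_le_transfer1 (f := restr_sub) _ _ _ ln).
- by move=> F _ _; split=> //; apply: zero_sub_min.
- by move=> F G _ _ FG x /submod_ofP/FG xG; apply/submod_ofP.
- move=> F G _ _ _ GF x xG.
  by have /GF/submod_ofP : (x : restr rho M) \in restr_sub G by apply/submod_ofP.
Qed.

Definition module_finite := exists (n : nat) (g : 'I_n -> S),
  forall s, exists a : 'I_n -> R, s = \sum_(i < n) rho (a i) * g i.

(** The products of generators of S over R with generators of M over S generate M over R. *)
Lemma restr_fin_len : fin_len R^o -> module_finite ->
  finitely_generated M -> fin_len (restr rho M).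
Proof.
move=> lR [p [g gen]] [q [m genM]].
have [K [n ln] gmK] :=
  fin_len_family (fun ij : 'I_p * 'I_q => g ij.1 *: m ij.2 : restr rho M) lR.
suff KT : K = full by exists n; rewrite -KT.
apply: eq_full => x; have [a ->] := genM x.
apply: (rpred_sum (V := restr rho M)) => j _; have [c ->] := gen (a j).
rewrite scaler_suml; apply: (rpred_sum (V := restr rho M)) => i _.
by rewrite -scalerA; apply: (rpredZ (V := restr rho M) (c i)); apply: (gmK (i, j)).
Qed.

End Structure.
End Restriction.

(** * A cogenerator *)

Lemma cseries_le (S : pzRingType) (M : lmodType S) (K N : submodClosed M) m n :
  cseries K N m -> len_le K N n -> (m <= n)%N.
Proof.
move=> c; elim: c n => {K N m} // K L N m [KL nKL _] cLN IH n ln.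
have nLK : ~ {subset L <= K} by move=> LK; apply: nKL => x; apply/idP/idP => [/KL|/LK].
have [n0 /IH] := len_le_above KL (cseries_sub cLN) nLK ln.
by case: n n0 {ln}.
Qed.

(** A proper image would have length at most n - 1, yet it carries a series of length n. *)
Lemma inj_onto (S : pzRingType) (M N : lmodType S) (f : {linear M -> N}) n :
  injective f -> cseries zero_sub (full : submodClosed M) n ->
  len_le zero_sub (full : submodClosed N) n -> forall y, exists x, f x = y.
Proof.
move=> f_inj cM lN y; apply: contrapT => yf.
have [] := len_le_below (zero_sub_min (img_sub f full)) (sub_full _) _ lN.
  move=> h; apply: yf; have /submod_ofP[x _ ->] := h y isT; by exists x.
move=> n0 lf; suff : (n <= n.-1)%N by rewrite leqNgt prednK ?leqnn.
apply: (cseries_le cM); apply: (len_le_transfer1 (f := img_sub f) _ _ _ lf).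
- move=> F _ _; split; first exact: zero_sub_min.
  by move=> _ /submod_ofP[x _ ->]; apply/submod_ofP; exists x.
- by move=> F G _ _ FG _ /submod_ofP[x /FG xG ->]; apply/submod_ofP; exists x.
- move=> F G _ _ _ h x xG; have /submod_ofP[z zF /f_inj->//] : f x \in img_sub f F.
  by apply: h; apply/submod_ofP; exists x.
Qed.

Section Cogenerator.
Variable R : comPzRingType.

(* [simple_elt e] says that [R e] is a simple module. *)
Definition simple_elt (V : lmodType R) (e : V) :=
  e <> 0 /\ forall r, r *: e <> 0 -> exists s, s *: (r *: e) = e.

(* The socle of V contains at most one copy of each simple module. *)
Definition mf_socle (V : lmodType R) := forall e f : V, simple_elt e ->
  (forall r, r *: e = 0 -> r *: f = 0) -> exists r, f = r *: e.

(** R f is a nonzero quotient of the simple module R e, hence isomorphic to it. *)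
Lemma simple_elt_ann (V W : lmodType R) (e : V) (f : W) : simple_elt e ->
  (forall r, r *: e = 0 -> r *: f = 0) -> f <> 0 ->
  simple_elt f /\ (forall r, r *: f = 0 -> r *: e = 0).
Proof.
move=> [e0 sime] ef f0.
have H r : r *: e <> 0 -> exists s, s *: (r *: f) = f.
  move=> /sime[s se]; exists s; apply/eqP; rewrite -subr_eq0 -{2}[f]scale1r.
  by rewrite scalerA -scalerBl ef // scalerBl -scalerA se scale1r subrr.
split=> [|r rf]; last first.
  by apply: contrapT => /H[s sf]; apply: f0; rewrite -sf rf scaler0.
by split=> // r rf; apply: H => /ef.
Qed.

Section Bilinear.
Variables (E V U : lmodType R) (b : V -> U -> E).
Hypothesis mfE : mf_socle E.
Hypothesis b_linearl : forall u, linear (b^~ u).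
Hypothesis b_linearr : forall v, linear (b v).

Let b0r v : b v 0 = 0. Proof. exact: (linear0 (linear_of (b_linearr v))). Qed.

Let bZl r v u : b (r *: v) u = r *: b v u.
Proof. exact: (linearZZ (linear_of (b_linearl u))). Qed.

Let bDl v w u : b (v + w) u = b v u + b w u.
Proof. exact: (linearD (linear_of (b_linearl u))). Qed.

Lemma perp_closed (K : submodClosed V) :
  closed_prop (fun u => forall v, v \in K -> b v u = 0).
Proof.
split=> [v _|a u w uK wK v vK]; first exact: b0r.
by rewrite b_linearr uK // wK // scaler0 addr0.
Qed.
Definition perp_sub K := submod_of (perp_closed K).

(** For L/K simple, the orthogonal of [K] modulo that of [L] embeds in Hom(L/K, E). As [E] has at
    most one copy of L/K, this is generated by any nonzero element: b x f = r (b x e) for a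
    generator [x] of [L] over [K], so f - r e is orthogonal to [L]. *)
Lemma len_le_perp K N n : cseries K N n -> len_le (perp_sub N) (perp_sub K) n.
Proof.
elim=> {K N n} [K|K L N n mKL cLN IH]; first exact: len_le_refl.
rewrite -addn1; apply: len_le_trans IH _.
- move=> u /submod_ofP uN; apply/submod_ofP => v vL; apply: uN.
  exact: cseries_sub cLN _ vL.
- have [KL _ _] := mKL; move=> u /submod_ofP uL; apply/submod_ofP => v vK.
  by apply: uL; apply: KL.
have [KL nKL maxK] := mKL; apply: len_le_simple => F LF FK.
have [|nFL] := pselect ({subset F <= perp_sub L}); first by left.
right=> f /submod_ofP fK.
have [e eF enL] := subNP nFL; have /submod_ofP eK := FK e eF.
have [x xL bxe] : exists2 x, x \in L & b x e <> 0.
  apply: contrapT => h; move/negP: enL; apply; apply/submod_ofP => x xL.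
  by apply: contrapT => bxe; apply: h; exists x.
have genL y : y \in L -> y \notin K ->
    forall z, z \in L -> exists2 k, k \in K & exists s, z = k + s *: y.
  move=> yL yK z zL; case: (maxK (add_sub K (cyclic_sub y))) => [||h|h].
  - exact: sub_addl.
  - by apply: add_sub_le => //; apply: cyclic_sub_le.
  - by move/negP: yK; case; rewrite -h; apply: sub_addr; apply: mem_cyclic.
  - move: zL; rewrite -h => /submod_ofP[k [_ [kK /submod_ofP[s ->] ->]]].
    by exists k => //; exists s.
have gen_e r : r *: x \notin K -> exists s, s *: (r *: b x e) = b x e.
  move=> rxK; have [k kK [s xE]] := genL (r *: x) (rpredZ _ xL) rxK x xL.
  by exists s; rewrite [in RHS]xE bDl (eK k kK) add0r !bZl.
have [|r rbe|r bxf] := mfE (e := b x e) (f := b x f).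
- split=> // r rb; apply: gen_e; apply/negP => rxK.
  by apply: rb; rewrite -bZl eK.
- rewrite -bZl fK //; apply: contrapT => /negP/gen_e[s]; rewrite rbe scaler0.
  by move=> /esym.
have xK : x \notin K by apply/negP => /eK.
suff fre : f - r *: e \in perp_sub L.
  by rewrite -(subrK (r *: e) f); apply: rpredD; [apply: LF|apply: rpredZ].
apply/submod_ofP => y yL; have [k kK [s ->]] := genL x xL xK y yL.
have -> : f - r *: e = (- r) *: e + f by rewrite scaleNr addrC.
rewrite bDl bZl !b_linearr (eK k kK) (fK k kK) bxf scaler0 addr0 add0r.
by rewrite -scalerDl addNr scale0r scaler0.
Qed.

Lemma len_le_pairing n : (forall u, (forall v, b v u = 0) -> u = 0) ->
  cseries zero_sub (full : submodClosed V) n -> len_le zero_sub (full : submodClosed U) n.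
Proof.
move=> b_nondeg /len_le_perp; apply: len_le_incl => u.
  by move=> /submod_ofP uT; rewrite mem_zero; apply/eqP; apply: b_nondeg => v; apply: uT.
move=> _; apply/submod_ofP => v; rewrite mem_zero => /eqP->.
exact: (linear0 (linear_of (b_linearl u))).
Qed.

End Bilinear.

(** Maximality is stated through embeddings, the form in which the cogenerator property uses it. *)
Definition max_mf_socle (E : lmodType R) := [/\ mf_socle E, fin_len E &
  forall (E' : lmodType R) (f : {linear E -> E'}), mf_socle E' -> injective f ->
    forall y, exists x, f x = y].

Lemma exists_max_mf_socle : fin_len R^o -> exists E, max_mf_socle E.
Proof.
move=> [l /(len_le_cseries (zero_sub_min full))[n _ cR]].
(* Scalar multiplication R x E -> E is a pairing, nondegenerate in [E] because 1 acts as the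
   identity; it bounds the length of [E] by that of R. *)
have mf_len (E : lmodType R) : mf_socle E -> len_le zero_sub (full : submodClosed E) n.
  move=> mfE; apply: (len_le_pairing (b := fun (r : R^o) (e : E) => (r : R) *: e) mfE _ _ _ cR).
  - by move=> e a x y; rewrite scalerDl scalerA.
  - by move=> r a x y; rewrite scalerDr !scalerA mulrC.
  - by move=> e /(_ 1); rewrite scale1r.
pose P m := exists2 E : lmodType R, mf_socle E & cseries zero_sub (full : submodClosed E) m.
have P0 : exists m, `[< P m >].
  exists 0%N; apply/asboolP; exists 'rV[R]_0.
    by move=> e f [e0]; case: e0; rewrite thinmx0.
  have -> : zero_sub = full :> submodClosed 'rV[R]_0; last exact: Cseries0.
  by apply: eq_full => x; rewrite thinmx0 rpred0.
have Pn m : `[< P m >] -> (m <= n)%N.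
  by move=> /asboolP[E mfE cE]; apply: cseries_le cE (mf_len E mfE).
case: (ex_maxnP P0 Pn) => m /asboolP[E mfE cE] maxm.
exists E; split=> //; first by exists n; apply: mf_len.
move=> E' f mfE' f_inj y.
have [k _ cE'] := len_le_cseries (zero_sub_min full) (mf_len E' mfE').
have km : (k <= m)%N by apply: maxm; apply/asboolP; exists E'.
exact: inj_onto f_inj cE (len_leW km (cseries_len_le cE')) y.
Qed.

(* In E x V choose C maximal such that C meets E trivially and misses (0, v).  The
   quotient still has a multiplicity-free socle, so by maximality E maps onto it;
   the induced map V -> E does not kill v. *)
Lemma max_mf_socle_cogenerator (E V : lmodType R) (v : V) :
  max_mf_socle E -> fin_len V -> v <> 0 -> exists f : {linear V -> E}, f v <> 0.
Proof.
move=> [mfE [m lE] maxE] [n lV] v0.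
pose Z := (E * V)%type.
have inE_lin : linear (fun e : E => (e, 0) : Z).
  by move=> a x y; rewrite [RHS]surjective_pairing /= scaler0 addr0.
pose inE : {linear E -> Z} := linear_of inE_lin.
have snd_lin : linear (snd : Z -> V) by [].
pose sndL : {linear Z -> V} := linear_of snd_lin.
have lZ : len_le zero_sub (full : submodClosed Z) (m + n).
  apply: (len_le_transfer (f := preim_sub inE) (g := img_sub sndL) _ _ _ lE lV).
  - by move=> F _ _; split=> //; apply: zero_sub_min.
  - move=> F G _ _ FG; split; first by move=> x; rewrite !mem_preim; apply: FG.
    by move=> _ /submod_ofP[x /FG xG ->]; apply/submod_ofP; exists x.
  - move=> F G _ _ FG h1 h2 x xG.
    have /submod_ofP[y yF xy] : sndL x \in img_sub sndL F.
      by apply: h2; apply/submod_ofP; exists x.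
    have xyE : x - y = inE (x.1 - y.1).
      by case: x y xy {xG yF} => x1 x2 [y1 y2] /= ->; congr (_, _); rewrite subrr.
    rewrite -(subrK y x) rpredD //.
    have := h1 (x.1 - y.1); rewrite !mem_preim -xyE; apply.
    by apply: submodB => //; apply: FG.
pose P (C : submodClosed Z) := (forall e, (e, 0) \in C -> e = 0) /\ (0, v) \notin C.
have P0 : P zero_sub.
  split=> [e|]; first by rewrite mem_zero => /eqP/(congr1 fst).
  by rewrite mem_zero; apply/eqP => /(congr1 snd)/v0.
have [C [[CE Cv] _ _ maxC]] := len_le_max lZ (zero_sub_min _) (sub_full _) P0.
pose q : {linear Z -> quot_mod C} := quot_map C.
pose io : {linear E -> quot_mod C} := q \o inE; pose vb := q (0, v).
have io_inj e : io e = 0 -> e = 0.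
  by move=> h; apply: CE; apply/quot_map_eq0.
have vb0 : vb <> 0 by move=> h; move/negP: Cv; apply; apply/quot_map_eq0.
(* Adjoining to [C] a preimage of [z] must break one of the two conditions in [P]. *)
have keyA z : z <> 0 -> (exists r e, e <> 0 /\ r *: z = io e) \/ (exists r, r *: z = vb).
  have [x <-] := quot_map_onto z => x0.
  pose D := add_sub C (cyclic_sub x).
  have nPD : ~ P D.
    move=> PD; apply/x0/quot_map_eq0; rewrite -(maxC D PD) //; last exact: sub_addl.
    by apply: sub_addr; apply: mem_cyclic.
  have DE y : y \in D -> exists r, r *: q x = q y.
    move=> /submod_ofP[c [_ [cC /submod_ofP[r ->] ->]]]; exists r.
    by rewrite /q linearD linearZZ /= (proj2 (quot_map_eq0 _ _) cC) add0r.
  have [/DE|vD] := boolP ((0, v) \in D); first by right.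
  left; apply: contrapT => h; apply: nPD; split=> // e eD.
  by apply: contrapT => e0; have [r rx] := DE _ eD; apply: h; exists r, e.
(* Apply [keyA] to the diagonal element [io e - z]: in both cases some nonzero multiple of [z] lies
   in the image of [io], and it generates [z]. *)
have keyB e z r : simple_elt (io e) -> simple_elt z -> r *: z = vb ->
    (forall s, s *: io e = 0 <-> s *: z = 0) -> exists f, z = io f.
  move=> sime [z0 simz] rz ann.
  have io_gen s f : s *: z <> 0 -> s *: z = io f -> exists f, z = io f.
    by move=> /simz[t tz] sz; exists (t *: f); rewrite linearZZ -sz.
  have [/eqP|/eqP u0] := eqVneq (io e - z) 0.
    by rewrite subr_eq0 => /eqP<-; exists e.
  have [[s [f [f0 sf]]]|[s su]] := keyA _ u0.
    apply: (io_gen s (s *: e - f)) => [/ann se0|].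
      move: sf; rewrite scalerBr (proj1 (ann s) se0) se0 subr0.
      by move=> /esym/io_inj.
    by rewrite linearB linearZZ -sf scalerBr opprB addrC subrK.
  have sE : s *: io e = (s + r) *: z by rewrite scalerDl rz -su scalerBr addrC subrK.
  apply: (io_gen (s + r) (s *: e)); last by rewrite linearZZ.
  rewrite -sE => se0; apply: vb0.
  by rewrite -su scalerBr (proj1 (ann s) se0) se0 subr0.
have io_injective : injective io.
  move=> x y /eqP; rewrite -subr_eq0 -linearB => /eqP/io_inj/eqP.
  by rewrite subr_eq0 => /eqP.
(* Each of two isomorphic simple elements lies in the image of [io] or generates [vb]. In the mixed
   cases [keyB] moves both into that image, where [mfE] applies; if both generate [vb], they
   generate the same submodule. *)
have mfQ : mf_socle (quot_mod C).
  move=> z y simz zy; have [->|/eqP y0] := eqVneq y 0.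
    by exists 0; rewrite scale0r.
  have [simy yz] := simple_elt_ann simz zy y0.
  have ann s : s *: z = 0 <-> s *: y = 0 by split; [apply: zy|apply: yz].
  have [z0 zgen] := simz; have [_ ygen] := simy.
  have dich x : simple_elt x -> (exists e, x = io e) \/ (exists r, r *: x = vb).
    move=> [x0 xgen]; have [[r [e [e0 rx]]]|] := keyA x x0; last by right.
    have [|s sx] := xgen r; first by rewrite rx => /io_inj.
    by left; exists (s *: e); rewrite linearZZ -rx sx.
  have both e f : z = io e -> y = io f -> exists r, y = r *: z.
    move=> zE yE; have [r fE] : exists r, f = r *: e; last by exists r; rewrite yE fE linearZZ zE.
    apply: mfE => [|r re].
      split=> [e0|r re]; first by apply: z0; rewrite zE e0 linear0.
      have [|s sz] := zgen r; first by rewrite zE -linearZZ => /io_inj.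
      exists s; apply: io_injective; rewrite linearZZ linearZZ -zE; exact: sz.
    by apply: io_inj; rewrite linearZZ -yE zy // zE -linearZZ re linear0.
  case: (dich z simz) (dich y simy) => [[e zE]|[r rz]] [[f yE]|[s sy]].
  - exact: both zE yE.
  - have [||f yE] := keyB e y s _ simy sy; [by rewrite -zE|by rewrite -zE|].
    exact: both zE yE.
  - have [||e zE] := keyB f z r _ simz rz; [by rewrite -yE|by move=> t; rewrite -yE ann|].
    exact: both zE yE.
  - have [|t <-] := ygen s; first by rewrite sy.
    by exists (t * r); rewrite sy -scalerA rz.
have /choice[f fP] x := maxE _ io mfQ io_injective (q (0, x)).
have f_lin : linear f.
  move=> a x y; apply: io_injective; rewrite linearP !fP -linearP.
  by congr (q _); rewrite [RHS]surjective_pairing /= scaler0 addr0.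
pose fL : {linear V -> E} := linear_of f_lin.
exists fL => /= fv.
by apply: vb0; rewrite /vb -fP fv linear0.
Qed.

End Cogenerator.

(** * Duality *)

Lemma fin_len_finitely_generated (S : pzRingType) (M : lmodType S) :
  fin_len M -> finitely_generated M.
Proof.
move=> [l ll].
pose P (K : submodClosed M) := exists n (g : 'I_n -> M),
  forall x, x \in K -> exists a : 'I_n -> S, x = \sum_(i < n) a i *: g i.
have P0 : P zero_sub.
  exists 0%N, (fun=> 0) => x; rewrite mem_zero => /eqP->.
  by exists (fun=> 0); rewrite big_ord0.
have [K [[n [g gen]] _ _ maxK]] := len_le_max ll (zero_sub_min _) (sub_full _) P0.
suff KT x : x \in K by exists n, g => x; apply: gen.
rewrite -(maxK (add_sub K (cyclic_sub x))) //; last exact: sub_addl.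
  by apply: sub_addr; apply: mem_cyclic.
exists n.+1, (fun i => if unlift ord0 i is Some j then g j else x).
move=> _ /submod_ofP[y [_ [/gen[a ->] /submod_ofP[c ->] ->]]].
exists (fun i => if unlift ord0 i is Some j then a j else c).
rewrite big_ord_recl unlift_none addrC; congr (_ + _).
by apply: eq_bigr => i _; rewrite liftK.
Qed.

Section Dual.
Variables (R : comPzRingType) (S T : pzRingType).
Variables (rhoS : {rmorphism R -> S}) (rhoT : {rmorphism R -> T}) (t : T -> S).
Hypothesis rhoS_central : forall r s, rhoS r * s = s * rhoS r.
Hypotheses (tD : {morph t : a b / a + b}) (t1 : t 1 = 1).
Hypotheses (tM : forall a b, t (a * b) = t b * t a) (t_rho : forall r, t (rhoT r) = rhoS r).
Variables (E : lmodType R) (M : lmodType S).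

Definition linear_pred : {pred (restr rhoS M -> E)} := fun f => `[< linear f >].

Fact linear_pred_closed : zmod_closed linear_pred.
Proof.
split; first by apply/asboolP => a x y; rewrite /= scaler0 addr0.
move=> f g /asboolP f_lin /asboolP g_lin; apply/asboolP => a x y /=.
rewrite -[LHS]/(f _ - g _) f_lin g_lin -[(f - g) x]/(f x - g x) -[(f - g) y]/(f y - g y).
by rewrite scalerBr opprD addrACA.
Qed.
HB.instance Definition _ := GRing.isZmodClosed.Build _ linear_pred linear_pred_closed.

Definition dual : Type := {f | f \in linear_pred}.
HB.instance Definition _ := SubType.on dual.
HB.instance Definition _ := Choice.on dual.
HB.instance Definition _ := [SubChoice_isSubZmodule of dual by <:].

Definition dual_eval (m : M) (f : dual) : E := val f m.

Lemma dual_eval_linear f : linear (dual_eval^~ f : restr rhoS M -> E).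
Proof. exact/asboolP/(valP f). Qed.

Lemma dual_evalD m f g : dual_eval m (f + g) = dual_eval m f + dual_eval m g.
Proof. by []. Qed.

Lemma dual_evalDl m m' f : dual_eval (m + m') f = dual_eval m f + dual_eval m' f.
Proof. exact: (linearD (linear_of (dual_eval_linear f))). Qed.

Lemma dual_evalZl r m f : dual_eval (rhoS r *: m) f = r *: dual_eval m f.
Proof. exact: (linearZZ (linear_of (dual_eval_linear f)) r (m : restr rhoS M)). Qed.

(** T acts on Hom_R(M, E) by precomposition with [t a]: centrality of [rhoS] keeps the result
    R-linear, and [t] reversing products makes this a left action. *)
Fact dual_scale_subproof (a : T) (f : dual) :
  (fun x : restr rhoS M => val f (t a *: (x : M))) \in linear_pred.
Proof.
apply/asboolP => r x y; rewrite -(dual_eval_linear f) /dual_eval; congr (val f _).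
by rewrite scalerDr !restr_scaleE !scalerA rhoS_central.
Qed.
Definition dual_scale a f : dual := exist (fun f => f \in linear_pred) _ (dual_scale_subproof a f).

Lemma dual_ext (f g : dual) : (forall m, dual_eval m f = dual_eval m g) -> f = g.
Proof. by move=> fg; apply: val_inj; apply: funext. Qed.

Fact dual_scalerA a b f : dual_scale a (dual_scale b f) = dual_scale (a * b) f.
Proof. by apply: dual_ext => m; rewrite /dual_eval /= tM scalerA. Qed.
Fact dual_scale1r : left_id 1 dual_scale.
Proof. by move=> f; apply: dual_ext => m; rewrite /dual_eval /= t1 scale1r. Qed.
Fact dual_scalerDr : right_distributive dual_scale +%R.
Proof. by move=> a f g; apply: dual_ext. Qed.
Fact dual_scalerDl f : {morph dual_scale^~ f : a b / a + b}.
Proof.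
move=> a b; apply: dual_ext => m; rewrite dual_evalD -!/(dual_eval _ _).
by rewrite /dual_eval /= tD scalerDl; apply: dual_evalDl.
Qed.

Definition dual_lmod : lmodType T := HB.pack dual
  (GRing.Zmodule_isLmodule.Build T dual
    dual_scalerA dual_scale1r dual_scalerDr dual_scalerDl).

End Dual.

(** V embeds in Hom(U, E). The pairing bounds the length of U by that of V, and evaluation bounds
    the length of Hom(U, E) by that of U, so the embedding is onto. *)
Lemma pairing_rep (R : comPzRingType) (E V U : lmodType R) (b : V -> U -> E)
    (phi : U -> E) :
  mf_socle E -> (forall u, linear (b^~ u)) -> (forall v, linear (b v)) ->
  (forall u, (forall v, b v u = 0) -> u = 0) ->
  (forall v, (forall u, b v u = 0) -> v = 0) ->
  fin_len V -> linear phi -> exists v, forall u, phi u = b v u.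
Proof.
move=> mfE bl br ndU ndV [n0 lV] phi_lin.
have [n _ cV] := len_le_cseries (zero_sub_min full) lV.
have lU := len_le_pairing mfE bl br ndU cV.
have [k kn cU] := len_le_cseries (zero_sub_min full) lU.
pose H := @dual_lmod R R R idfun id (fun r s => mulrC r s) (fun _ _ => erefl) erefl
  (fun a b => mulrC a b) E U.
have lH : len_le zero_sub (full : submodClosed H) k.
  apply: (len_le_pairing (b := fun (u : U) (f : H) => dual_eval u f) mfE _ _ _ cU).
  - by move=> f a x y; apply: (dual_eval_linear f).
  - by move=> u a f g; rewrite dual_evalD; congr (_ + _); apply: (dual_evalZl a u f).
  - by move=> f f0; apply: dual_ext => u; rewrite f0.
have bv_lin v : b v \in @linear_pred R R idfun E U.
  by apply/asboolP => a x y; rewrite -br.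
pose B v : H := exist (fun f => f \in @linear_pred R R idfun E U) _ (bv_lin v).
have B_lin : linear B.
  move=> a x y; apply: dual_ext => u; rewrite /dual_eval /= bl.
  congr (_ + _); exact/esym/(linearZZ (linear_of (br x))).
pose BL : {linear V -> H} := linear_of B_lin.
have B_inj : injective BL.
  move=> x y /eqP; rewrite -subr_eq0 -linearB => /eqP B0.
  apply/eqP; rewrite -subr_eq0; apply/eqP; apply: ndV => u.
  by have := congr1 (dual_eval u) B0.
have phiP : phi \in @linear_pred R R idfun E U.
  by apply/asboolP => a x y; rewrite -phi_lin.
have [v Bv] := inj_onto B_inj cV (len_leW kn lH)
  (exist (fun f => f \in @linear_pred R R idfun E U) _ phiP).
by exists v => u; exact: esym (congr1 (dual_eval u) Bv).
Qed.

(* [t] and [u] are mutually inverse anti-isomorphisms between [T] and [S]; for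
   an algebra and its converse both are the identity.  Keeping the two rings
   symmetric lets every statement be applied to the flipped pairing as well. *)
Definition perfect (R : comPzRingType) (S T : pzRingType)
    (rhoS : {rmorphism R -> S}) (rhoT : {rmorphism R -> T})
    (t : T -> S) (u : S -> T) (E : lmodType R) (M : lmodType S) (N : lmodType T)
    (b : M -> N -> E) : Prop :=
  [/\ (forall n, linear (b^~ n : restr rhoS M -> E)) /\
      (forall m, linear (b m : restr rhoT N -> E)),
      (forall s m n, b (s *: m) n = b m (u s *: n)) /\
      (forall a m n, b (t a *: m) n = b m (a *: n)),
      (forall f : restr rhoS M -> E, linear f -> exists n, forall m, f m = b m n) /\
      (forall f : restr rhoT N -> E, linear f -> exists m, forall n, f n = b m n) &
      (forall m, (forall n, b m n = 0) -> m = 0) /\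
      (forall n, (forall m, b m n = 0) -> n = 0)].

Lemma perfect_flip (R : comPzRingType) (S T : pzRingType)
    (rhoS : {rmorphism R -> S}) (rhoT : {rmorphism R -> T})
    (t : T -> S) (u : S -> T) (E : lmodType R) (M : lmodType S) (N : lmodType T)
    (b : M -> N -> E) :
  perfect rhoS rhoT t u b -> perfect rhoT rhoS u t (fun n m => b m n).
Proof. by case=> [[bl br] [bs bt] [rl rr] [nl nr]]; split; split. Qed.

(** * Adjoints and orthogonals for perfect pairings *)

Section Perfect.
Variables (R : comPzRingType) (S T : pzRingType).
Variables (rhoS : {rmorphism R -> S}) (rhoT : {rmorphism R -> T}).
Variables (t : T -> S) (u : S -> T) (E : lmodType R).
Hypothesis maxE : max_mf_socle E.

(** [g' n'] represents the functional sending m to b' (g m) n'; nondegeneracy makes the choice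
    linear. *)
Lemma perfect_adjoint (M M' : lmodType S) (N N' : lmodType T)
    (b : M -> N -> E) (b' : M' -> N' -> E) (g : {linear M -> M'}) :
  perfect rhoS rhoT t u b -> perfect rhoS rhoT t u b' ->
  exists g' : {linear N' -> N}, forall m n', b m (g' n') = b' (g m) n'.
Proof.
move=> [[bl br] [_ bt] [rl _] [_ nr]] [[bl' br'] [_ bt'] _ _].
have gl n' : linear (fun m : restr rhoS M => b' (g m) n').
  by move=> r x y; rewrite linearD restr_scaleE linearZZ; apply: bl'.
have /choice[g' g'P] n' := rl _ (gl n').
have bD m : {morph b m : x y / x + y}.
  by move=> x y; apply: (linearD (linear_of (br m))).
have bD' m : {morph b' m : x y / x + y}.
  by move=> x y; apply: (linearD (linear_of (br' m))).
have bB m x y : b m (x - y) = b m x - b m y.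
  exact: (linearB (linear_of (br m))).
have g'_lin : linear g'.
  move=> a x y; apply/eqP; rewrite -subr_eq0; apply/eqP/nr => m.
  by rewrite bB bD -bt -!g'P linearZZ bt' bD' subrr.
by exists (linear_of g'_lin) => m n'; rewrite -g'P.
Qed.

Section Pair.
Variables (M : lmodType S) (N : lmodType T) (b : M -> N -> E).
Hypothesis perf : perfect rhoS rhoT t u b.
Implicit Types (K : submodClosed M) (L : submodClosed N).

Let b0l n : b 0 n = 0.
Proof. have [[bl _] _ _ _] := perf; exact: (linear0 (linear_of (bl n))). Qed.

Let b0r m : b m 0 = 0.
Proof. have [[_ br] _ _ _] := perf; exact: (linear0 (linear_of (br m))). Qed.

Let bDl m m' n : b (m + m') n = b m n + b m' n.
Proof. have [[bl _] _ _ _] := perf; exact: (linearD (linear_of (bl n))). Qed.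

Let bDr m n n' : b m (n + n') = b m n + b m n'.
Proof. have [[_ br] _ _ _] := perf; exact: (linearD (linear_of (br m))). Qed.

Lemma perpl_closed (K : submodClosed M) : closed_prop (fun n => forall m, m \in K -> b m n = 0).
Proof.
have [_ [_ bt] _ _] := perf; split=> [m _|a x y xK yK m mK]; first exact: b0r.
by rewrite bDr -bt (xK (t a *: m)) ?rpredZ // (yK m mK) addr0.
Qed.
Definition perpl K := submod_of (perpl_closed K).

Lemma perpr_closed (L : submodClosed N) : closed_prop (fun m => forall n, n \in L -> b m n = 0).
Proof.
have [_ [bs _] _ _] := perf; split=> [n _|a x y xL yL n nL]; first exact: b0l.
by rewrite bDl bs (xL (u a *: n)) ?rpredZ // (yL n nL) addr0.
Qed.
Definition perpr L := submod_of (perpr_closed L).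

Lemma perpl_anti K K' : {subset K <= K'} -> {subset perpl K' <= perpl K}.
Proof. by move=> KK n /submod_ofP nK; apply/submod_ofP => m /KK/nK. Qed.

Lemma perpr_anti L L' : {subset L <= L'} -> {subset perpr L' <= perpr L}.
Proof. by move=> LL m /submod_ofP mL; apply/submod_ofP => n /LL/mL. Qed.

(** For [m] outside [K], the cogenerator gives a functional on M/K that is nonzero at [m]; the
    element of N representing it is orthogonal to [K] but not to [m]. *)
Lemma perplK K : fin_len (restr rhoS M) -> perpr (perpl K) = K.
Proof.
move=> lM; apply: submod_sub_eq => m; last first.
  by move=> mK; apply/submod_ofP => n /submod_ofP; apply.
move=> /submod_ofP mK; apply: contrapT => nmK.
pose K' := restr_sub rhoS K.
have [||f fm] := max_mf_socle_cogenerator (v := quot_map K' m) maxE.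
- exact: fin_len_img (@quot_map_onto _ _ K') lM.
- by move=> /quot_map_eq0/submod_ofP.
have [_ _ [rl _] _] := perf.
have [|n nP] := rl (fun x : restr rhoS M => f (quot_map K' x)).
  by move=> a x y; rewrite !linearP.
apply: fm; rewrite nP; apply: mK; apply/submod_ofP => x xK.
have /quot_map_eq0 x0 : (x : restr rhoS M) \in K' by apply/submod_ofP.
by rewrite -nP x0 linear0.
Qed.

Lemma perfect_serial : fin_len (restr rhoS M) -> serial N -> serial M.
Proof.
move=> lM sN K K'; rewrite -(perplK K lM) -(perplK K' lM).
by case: (sN (perpl K) (perpl K')) => /perpr_anti; [right|left].
Qed.

End Pair.
End Perfect.

Section Duality.
Variables (R : comPzRingType) (S T : pzRingType).
Variables (rhoS : {rmorphism R -> S}) (rhoT : {rmorphism R -> T}).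
Variables (t : T -> S) (u : S -> T) (E : lmodType R).
Hypothesis maxE : max_mf_socle E.

(** Taking orthogonals swaps sums with intersections, so a decomposition of N yields one of M. *)
Lemma perfect_indecomposable (M : lmodType S) (N : lmodType T) (b : M -> N -> E) :
  perfect rhoS rhoT t u b -> fin_len (restr rhoS M) -> fin_len (restr rhoT N) ->
  indecomposable M -> indecomposable N.
Proof.
move=> perf lM lN [[m m0] indM].
have [[bl br] _ _ [nl nr]] := perf.
have perprK L : perpl perf (perpr perf L) = L.
  by rewrite -[RHS](perplK maxE (perfect_flip perf) L lN); apply: submod_ext.
split.
  apply: contrapT => nN; move/eqP: m0; apply; apply: nl => n.
  have -> : n = 0 by apply: contrapT => /eqP n0; apply: nN; exists n.
  exact: (linear0 (linear_of (br m))).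
move=> K L KL0 KL.
have [x xK xL|x|K0|L0] := indM (perpr perf K) (perpr perf L).
- apply: nl => n; have [y [z [yK zL ->]]] := KL n.
  move/submod_ofP: xK => /(_ y yK) xy; move/submod_ofP: xL => /(_ z zL) xz.
  have -> : b x (y + z) = b x y + b x z by exact: (linearD (linear_of (br x))).
  by rewrite xy xz addr0.
- suff /submod_ofP : x \in add_sub (perpr perf K) (perpr perf L) by [].
  rewrite -(perplK maxE perf (add_sub _ _) lM); apply/submod_ofP => n nKL.
  have -> : n = 0; last exact: (linear0 (linear_of (br x))).
  apply: KL0; [rewrite -(perprK K)|rewrite -(perprK L)].
    exact: (perpl_anti sub_addl nKL).
  exact: (perpl_anti sub_addr nKL).
- right=> n; apply/idP/eqP => [nL|->]; last exact: rpred0.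
  apply: KL0 => //; rewrite -(perprK K); apply/submod_ofP => y.
  by rewrite K0 => /eqP->; exact: (linear0 (linear_of (bl n))).
- left=> n; apply/idP/eqP => [nK|->]; last exact: rpred0.
  apply: KL0 => //; rewrite -(perprK L); apply/submod_ofP => y.
  by rewrite L0 => /eqP->; exact: (linear0 (linear_of (bl n))).
Qed.

(** A lifting problem for M dualises to an extension problem for N: the adjoint of an onto map is
    injective, and the adjoint of an extension is a lift. *)
Lemma perfect_projective (M : lmodType S) (N : lmodType T) (b : M -> N -> E) :
  perfect rhoS rhoT t u b ->
  (forall X : lmodType S, finitely_generated X -> exists (Y : lmodType T)
     (c : X -> Y -> E), finitely_generated Y /\ perfect rhoS rhoT t u c) ->
  injective_module N -> projective_module M.
Proof.
move=> perf dualS injN X Y g h fgX fgY g_onto.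
have [X' [bX [fgX' perfX]]] := dualS X fgX.
have [Y' [bY [fgY' perfY]]] := dualS Y fgY.
have [g' g'P] := perfect_adjoint g perfX perfY.
have [h' h'P] := perfect_adjoint h perf perfY.
have [[blY brY] _ _ [nlY nrY]] := perfY.
have g'_inj : injective g'.
  move=> x y gxy; apply/eqP; rewrite -subr_eq0; apply/eqP/nrY => z.
  have [w <-] := g_onto z; rewrite -g'P linearB gxy subrr.
  by have [[_ br] _ _ _] := perfX; exact: (linear0 (linear_of (br w))).
have [k' k'P] := injN _ _ g' h' fgY' fgX' g'_inj.
have [k kP] := perfect_adjoint k' (perfect_flip perfX) (perfect_flip perf).
exists k => m; apply/eqP; rewrite -subr_eq0; apply/eqP/nlY => y.
have -> : bY (g (k m) - h m) y = bY (g (k m)) y - bY (h m) y.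
  exact: (linearB (linear_of (blY y))).
by rewrite -g'P (kP (g' y) m) k'P h'P subrr.
Qed.

End Duality.

(** The pairing is evaluation. Nondegeneracy in M is the cogenerator property, and [pairing_rep]
    shows that every functional on the dual is evaluation at an element of M. *)
Lemma dual_perfect (R : comPzRingType) (S T : pzRingType)
    (rhoS : {rmorphism R -> S}) (rhoT : {rmorphism R -> T}) (t : T -> S) (u : S -> T)
    (rhoS_central : forall r s, rhoS r * s = s * rhoS r)
    (tD : {morph t : a b / a + b}) (t1 : t 1 = 1)
    (tM : forall a b, t (a * b) = t b * t a) (t_rho : forall r, t (rhoT r) = rhoS r)
    (uK : forall s, t (u s) = s) (E : lmodType R) (M : lmodType S) :
  max_mf_socle E -> fin_len (restr rhoS M) ->
  exists (N : lmodType T) (b : M -> N -> E),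
    [/\ finitely_generated N, fin_len (restr rhoT N) & perfect rhoS rhoT t u b].
Proof.
move=> maxE lM; have [mfE _ _] := maxE.
pose N := dual_lmod rhoS_central tD t1 tM E M.
pose b (m : M) (f : N) := dual_eval m f.
have bl f : linear (b^~ f : restr rhoS M -> E) by apply: dual_eval_linear.
have bt a m f : b (t a *: m) f = b m (a *: f) by [].
have br m : linear (b m : restr rhoT N -> E).
  move=> r f g; rewrite /b dual_evalD restr_scaleE -/(b _ _) -/(b _ _) -bt t_rho.
  by congr (_ + _); apply: dual_evalZl.
have nr f : (forall m, b m f = 0) -> f = 0 by move=> f0; apply: dual_ext.
have nl m : (forall f, b m f = 0) -> m = 0.
  move=> m0; apply: contrapT => mn0.
  have [f fm] := max_mf_socle_cogenerator (v := m : restr rhoS M) maxE lM mn0.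
  have fP : (f : restr rhoS M -> E) \in @linear_pred R S rhoS E M.
    by apply/asboolP => a x y; rewrite linearP.
  exact/fm/(m0 (exist (fun f => f \in @linear_pred R S rhoS E M) _ fP)).
have [l lM'] := lM; have [k _ cM] := len_le_cseries (zero_sub_min full) lM'.
have lN : fin_len (restr rhoT N).
  by exists k; apply: (len_le_pairing (b := b : restr rhoS M -> restr rhoT N -> E) mfE bl br nr cM).
exists N, b; split=> //.
  by apply: fin_len_finitely_generated; apply: fin_len_restr lN.
split; split=> //.
- by move=> s m f; rewrite -bt uK.
- move=> f f_lin; have fP : f \in @linear_pred R S rhoS E M by apply/asboolP.
  by exists (exist (fun f => f \in @linear_pred R S rhoS E M) _ fP).
- move=> f f_lin.
  exact: (pairing_rep (b := b : restr rhoS M -> restr rhoT N -> E) mfE bl br nr nl lM f_lin).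
Qed.

(** * Artin algebras *)

Section ArtinAlgebra.
Variables (R : comPzRingType) (A : algType R).

Definition alg_scalar (r : R) : A := r%:A.
Definition alg_scalarC (r : R) : A^c := r%:A.

Fact alg_scalar_zmod : zmod_morphism alg_scalar.
Proof. by move=> r s; apply: scalerBl. Qed.
Fact alg_scalar_monoid : monoid_morphism alg_scalar.
Proof.
by split=> [|r s]; rewrite /alg_scalar ?scale1r // -scalerAl mul1r scalerA.
Qed.
HB.instance Definition _ := GRing.isZmodMorphism.Build R A alg_scalar alg_scalar_zmod.
HB.instance Definition _ := GRing.isMonoidMorphism.Build R A alg_scalar alg_scalar_monoid.

Fact alg_scalarC_zmod : zmod_morphism alg_scalarC.
Proof. by move=> r s; apply: scalerBl. Qed.
Fact alg_scalarC_monoid : monoid_morphism alg_scalarC.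
Proof.
split=> [|r s]; first exact: scale1r.
by rewrite mulrC; apply: alg_scalar_monoid.2.
Qed.
HB.instance Definition _ := GRing.isZmodMorphism.Build R A^c alg_scalarC alg_scalarC_zmod.
HB.instance Definition _ := GRing.isMonoidMorphism.Build R A^c alg_scalarC alg_scalarC_monoid.

Lemma alg_scalar_central r (s : A) : alg_scalar r * s = s * alg_scalar r.
Proof. by rewrite /alg_scalar mulr_algl mulr_algr. Qed.

Lemma alg_scalarC_central r (s : A^c) : alg_scalarC r * s = s * alg_scalarC r.
Proof. exact/esym/alg_scalar_central. Qed.

Hypothesis artA : artin_algebra A.

Lemma base_fin_len : fin_len R^o.
Proof. by case: artA => /hopkins. Qed.

Lemma alg_module_finite : module_finite alg_scalar.
Proof.
have [_ [n [g gen]]] := artA; exists n, g => s; have [a ->] := gen s; exists a.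
by apply: eq_bigr => i _; rewrite /= mulr_algl.
Qed.

Lemma algC_module_finite : module_finite alg_scalarC.
Proof.
have [_ [n [g gen]]] := artA; exists n, g => s; have [a ->] := gen s; exists a.
apply: eq_bigr => i _; exact/esym/(mulr_algr (a i) (g i : A)).
Qed.

Lemma left_fin_len (M : lmodType A) : finitely_generated M -> fin_len (restr alg_scalar M).
Proof. exact: restr_fin_len base_fin_len alg_module_finite. Qed.

Lemma right_fin_len (M : lmodType A^c) :
  finitely_generated M -> fin_len (restr alg_scalarC M).
Proof. exact: restr_fin_len base_fin_len algC_module_finite. Qed.

Lemma left_dual (E : lmodType R) (M : lmodType A) : max_mf_socle E ->
  finitely_generated M -> exists (N : lmodType A^c) (b : M -> N -> E),
    [/\ finitely_generated N, fin_len (restr alg_scalarC N) &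
       perfect alg_scalar alg_scalarC (id : A^c -> A) (id : A -> A^c) b].
Proof. by move=> maxE /left_fin_len; apply: dual_perfect => //; apply: alg_scalar_central. Qed.

Lemma right_dual (E : lmodType R) (M : lmodType A^c) : max_mf_socle E ->
  finitely_generated M -> exists (N : lmodType A) (b : M -> N -> E),
    [/\ finitely_generated N, fin_len (restr alg_scalar N) &
       perfect alg_scalarC alg_scalar (id : A -> A^c) (id : A^c -> A) b].
Proof. by move=> maxE /right_fin_len; apply: dual_perfect => //; apply: alg_scalarC_central. Qed.

End ArtinAlgebra.

Theorem corollary5p9 (R : comPzRingType) (A : algType R)
    (artA : artin_algebra A) :
  ((forall M : lmodType A^c, finitely_generated M -> indecomposable M ->
      ~ projective_module M -> uniserial M) ->
    Nakayama A \/ right_2Nakayama A)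
  /\
  ((forall M : lmodType A^c, finitely_generated M -> indecomposable M ->
      ~ injective_module M -> uniserial M) ->
    Nakayama A \/ left_2Nakayama A).
Proof.
have lenR (M : lmodType A^c) : finitely_generated M -> fin_len M.
  by move=> /(right_fin_len artA)/fin_len_restr.
have lenL (M : lmodType A) : finitely_generated M -> fin_len M.
  by move=> /(left_fin_len artA)/fin_len_restr.
split=> [nonproj|noninj].
  have [uni|] := uniserial_or_two_Nakayama lenR nonproj; last by right.
  by left=> M fgM indM _; apply: uni.
have [E maxE] := exists_max_mf_socle (base_fin_len artA).
(* The module-theoretic result is applied to left modules. The dual of a non-projective left module
   is not injective, so it is uniserial by assumption, and duality carries this back. *)
have [M fgM indM nprojM|uni|] := uniserial_or_two_Nakayama (S := A) lenL; last by right.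
  have [N [b [fgN lN perf]]] := left_dual artA maxE fgM.
  have lM := left_fin_len artA fgM.
  apply/(uniserialP (lenL M fgM))/(perfect_serial maxE perf lM).
  apply/(uniserialP (lenR N fgN))/noninj => //.
    exact: (perfect_indecomposable maxE perf lM lN indM).
  move=> injN; apply: nprojM; apply: perfect_projective perf _ injN => X fgX.
  by have [Y [c [fgY _ perfc]]] := left_dual artA maxE fgX; exists Y, c.
(* If all indecomposable left modules are uniserial, then by duality so are all indecomposable right
   ones. *)
left=> N fgN indN _; have [M [b [fgM lM perf]]] := right_dual artA maxE fgN.
have lN := right_fin_len artA fgN.
apply/(uniserialP (lenR N fgN))/(perfect_serial maxE perf lN).
apply/(uniserialP (lenL M fgM))/uni => //.
exact: (perfect_indecomposable maxE perf lN lM indN).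
Qed.
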